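(* Let $\Bbbk$ be a field with $\mathrm{char}(\Bbbk)\ne 2$, let $H_4$ be Sweedler's Hopf algebra and let $A=Cl(\alpha,\beta,\gamma)$ with its canonical $H_4$-comodule algebra structure. The integrals on $(H_4,\psi)$ are exactly the $\Bbbk$-linear maps $\mathfrak{T}:H_4\to A\otimes H_4^{\mathrm{op}}$ defined by $$\begin{aligned} \mathfrak{T}(1_{H_4})&=\mathbf{U}(1_A\otimes 1_{H_4})+\mathbf{V}(GX\otimes 1_{H_4})+\mathbf{V}(G\otimes x),\\ \mathfrak{T}(g)&=\mathbf{A}(1_A\otimes g)+\mathbf{B}(G\otimes 1_{H_4})+\mathbf{Z}(GX\otimes g)-\mathbf{Z}(G\otimes gx),\\ \mathfrak{T}(x)&=-\tfrac{\gamma}{2}\mathbf{B}(1_A\otimes 1_{H_4})+\mathbf{B}(GX\otimes 1_{H_4})+\beta\mathbf{Z}(G\otimes g)-\mathbf{A}(1_A\otimes gx)-\mathbf{Z}(GX\otimes gx),\\ \mathfrak{T}(gx)&=\mathbf{D}(1_A\otimes x)+\mathbf{V}(GX\otimes x)+\tfrac{\gamma}{2}\mathbf{E}(1_A\otimes g)-\mathbf{C}(G\otimes 1_{H_4})+[\mathbf{D}-\mathbf{U}](X\otimes 1_{H_4})\\ &\quad-\mathbf{E}(GX\otimes g)+\mathbf{E}(G\otimes gx), \end{aligned}$$ with $\mathbf{A},\mathbf{B},\mathbf{C},\mathbf{D},\mathbf{E},\mathbf{U},\mathbf{V},\mathbf{Z}\in\Bbbk$ satisfying $$\begin{cases}\mathbf{Z}\alpha=\mathbf{Z}\gamma=0,\\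 \mathbf{V}\alpha=\mathbf{V}\beta=\mathbf{V}\gamma=0,\\ (\mathbf{D}-\mathbf{U})\gamma-2\mathbf{C}\alpha=0,\\ 2(\mathbf{D}-\mathbf{U})\beta-\mathbf{C}\gamma=0.\end{cases}$$ An integral of this kind is total if and only if $\mathbf{U}=1$ and $\mathbf{V}=0$.
   Context: Everything is over a field $\Bbbk$ with $\mathrm{char}(\Bbbk)\ne2$; $\otimes=\otimes_\Bbbk$; Sweedler notation with suppressed summation is used. $H_4=E(1)$ is the 4-dimensional Hopf algebra generated by $g,x$ with $g^2=1$, $x^2=0$, $gx=-xg$, $\Delta(g)=g\otimes g$, $\varepsilon(g)=1$, $S(g)=g$, $\Delta(x)=x\otimes g+1\otimes x$, $\varepsilon(x)=0$, $S(x)=gx$; basis $1,g,x,gx$. $Cl(\alpha,\beta,\gamma)$, for $\alpha,\beta,\gamma\in\Bbbk$, is the 4-dimensional unital associative algebra generated by $G,X$ with $G^2=\alpha$, $X^2=\beta$, $GX+XG=\gamma$; basis $1_A,G,X,GX$. Its canonical $H_4$-comodule algebra structure is the algebra map $\rho$ with $\rho(G)=G\otimes g$, $\rho(X)=X\otimes g+1_A\otimes x$. For a Hopf algebra $H$ with bijective antipode and right $H$-comodule algebra $(A,\rho)$, $\rho(a)=a_0\otimes a_1$, the cowreath $(A\otimes H^{\mathrm{op}},H,\psi)$ has $\psi(h\otimes a\otimes l)=a_0\otimes l_1\otimes l_2ha_1$. Convention: products written without symbol in $A\otimes H$ use the ordinary multiplications of $A$ and $H$ (not the opposite one). An integral on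 $(H,\psi)$ is a $\Bbbk$-linear map $\mathfrak{T}:H\to A\otimes H^{\mathrm{op}}$, $\mathfrak{T}(h)=\mathfrak{T}^A(h)\otimes\mathfrak{T}^H(h)$, such that for all $a\in A,h\in H$: $$\mathfrak{T}^A(h_2)_0\otimes \mathfrak{T}^H(h_2)_1\otimes \mathfrak{T}^H(h_2)_2h_1\mathfrak{T}^A(h_2)_1=\mathfrak{T}(h)\otimes 1_H,$$ $$(a_0\otimes 1_H)\mathfrak{T}(S^{-1}(a_2)ha_1)(1_A\otimes S^{-1}(a_3))=(1_A\otimes S^{-1}(a_1))\mathfrak{T}(h)(a_0\otimes 1_H).$$ It is total if $\mathfrak{T}(1_H)=1_A\otimes 1_H$. *)

(* Defs.v *)
From HB Require Import structures.
From mathcomp Require Import all_boot all_order all_algebra all_field.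
From mathcomp Require Import ring.

Set Implicit Arguments.
Unset Strict Implicit.
Unset Printing Implicit Defensive.

Import GRing.Theory VectorInternalTheory.
Local Open Scope ring_scope.

Reserved Notation "a \ox b" (at level 38, left associativity).
Reserved Notation "\sw_ ( a , b <- t ) F"
  (at level 41, F at level 41, a name, b name, t at level 50,
   format "'[' \sw_ ( a ,  b  <-  t ) '/  '  F ']'").

(* Tensor products of finite-dimensional algebras, in coordinates with        *)
(* respect to the library's standard bases; sweedler_ox and sweedler_uniq are *)
(* the universal property.                                                    *)

Section TensorModule.
Variables (k : fieldType) (A B : falgType k).

Definition tens : Type := 'M[k]_(dim A, dim B).
HB.instance Definition _ := Vector.copy tens 'M[k]_(dim A, dim B).

Definition ox (a : A) (b : B) : tens := (v2r a)^T *m v2r b.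

Definition std_basis (V : vectType k) (i : 'I_(dim V)) : V :=
  r2v (delta_mx 0 i).

(* The Sweedler convention: sweedler F t is the value on t of the linear map  *)
(* a \ox b |-> F a b, for F bilinear.                                         *)
Definition sweedler (W : lmodType k) (F : A -> B -> W) (t : tens) : W :=
  \sum_i \sum_j t i j *: F (std_basis i) (std_basis j).

End TensorModule.

Notation "A \ox B" := (tens A%type B%type) : type_scope.
Notation "a \ox b" := (ox a b) : ring_scope.
Notation "\sw_ ( a , b <- t ) F" := (sweedler (fun a b => F) t) : ring_scope.

Section TensorTheory.
Variables (k : fieldType) (A B : falgType k).
Implicit Types (a : A) (b : B) (t s : A \ox B) (W : lmodType k).

Definition bilin W (F : A -> B -> W) :=
  (forall b, linear (F^~ b)) /\ (forall a, linear (F a)).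

Lemma ox_bilin : bilin (@ox k A B).
Proof.
by split=> [b c a a'|a c b b'];
  rewrite /ox linearP /= ?linearP /= ?mulmxDl ?mulmxDr ?scalemxAl ?scalemxAr.
Qed.

Lemma oxDl a a' b : (a + a') \ox b = a \ox b + a' \ox b.
Proof. by have := ox_bilin.1 b 1 a a'; rewrite !scale1r. Qed.
Lemma oxDr a b b' : a \ox (b + b') = a \ox b + a \ox b'.
Proof. by have := ox_bilin.2 a 1 b b'; rewrite !scale1r. Qed.
Lemma ox0l b : 0 \ox b = 0 :> A \ox B.
Proof. by rewrite /ox linear0 trmx0 mul0mx. Qed.
Lemma ox0r a : a \ox 0 = 0 :> A \ox B.
Proof. by rewrite /ox linear0 mulmx0. Qed.
Lemma oxZl c a b : (c *: a) \ox b = c *: (a \ox b).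
Proof. by have := ox_bilin.1 b c a 0; rewrite ox0l !addr0. Qed.
Lemma oxZr c a b : a \ox (c *: b) = c *: (a \ox b).
Proof. by have := ox_bilin.2 a c b 0; rewrite ox0r !addr0. Qed.
Lemma oxNl a b : (- a) \ox b = - (a \ox b).
Proof. by rewrite -scaleN1r oxZl scaleN1r. Qed.
Lemma oxNr a b : a \ox (- b) = - (a \ox b).
Proof. by rewrite -scaleN1r oxZr scaleN1r. Qed.
Definition oxE := (oxDl, oxDr, oxZl, oxZr, oxNl, oxNr, ox0l, ox0r).

Lemma v2r_std_basis (V : vectType k) (i : 'I_(dim V)) :
  v2r (std_basis i) = delta_mx 0 i.
Proof. exact: r2vK. Qed.

Lemma std_basisE (V : vectType k) (v : V) : v = \sum_i v2r v 0 i *: std_basis i.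
Proof.
rewrite -[LHS]v2rK [in LHS](row_sum_delta (v2r v)) linear_sum /=.
by apply: eq_bigr => i _; rewrite linearZ.
Qed.

Lemma tensE t : t = \sw_(a, b <- t) a \ox b.
Proof.
rewrite [LHS]matrix_sum_delta; apply: eq_bigr => i _; apply: eq_bigr => j _.
by rewrite /ox !v2r_std_basis trmx_delta mul_delta_mx.
Qed.

Lemma sweedler_linear W (F : A -> B -> W) : linear (sweedler F).
Proof.
move=> c t s; rewrite /sweedler scaler_sumr -big_split; apply: eq_bigr => i _.
rewrite scaler_sumr -big_split; apply: eq_bigr => j _ /=.
by rewrite !mxE scalerDl scalerA.
Qed.

HB.instance Definition _ W (F : A -> B -> W) :=
  GRing.isLinear.Build k (tens A B) W _ (sweedler F) (sweedler_linear F).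

Lemma sweedler_ox W (F : A -> B -> W) a b :
  bilin F -> sweedler F (a \ox b) = F a b.
Proof.
move=> [Fl Fr].
pose fl b' : {linear A -> W} :=
  HB.pack (F^~ b') (GRing.isLinear.Build k A W _ (F^~ b') (Fl b')).
pose fr a' : {linear B -> W} :=
  HB.pack (F a') (GRing.isLinear.Build k B W _ (F a') (Fr a')).
rewrite [in RHS](std_basisE a) -[RHS]/(fl b _) linear_sum.
apply: eq_bigr => i _; rewrite linearZ /=.
rewrite [in RHS](std_basisE b) -[F _ _]/(fr (std_basis i) _) linear_sum.
rewrite scaler_sumr; apply: eq_bigr => j _.
by rewrite linearZ /= scalerA; congr (_ *: _); rewrite mxE big_ord1 !mxE.
Qed.

Lemma sweedler_param (U : lmodType k) W (F : U -> A -> B -> W) t :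
  (forall a b, linear (fun u => F u a b)) -> linear (fun u => sweedler (F u) t).
Proof.
move=> Flin c u v; rewrite /sweedler scaler_sumr -big_split.
apply: eq_bigr => i _; rewrite scaler_sumr -big_split; apply: eq_bigr => j _ /=.
by rewrite Flin scalerDr !scalerA mulrC.
Qed.

Lemma tens_ind (P : A \ox B -> Prop) :
  (forall t s, P t -> P s -> P (t + s)) -> (forall a b, P (a \ox b)) ->
  forall t, P t.
Proof.
move=> PD Pox t; have P0 : P 0 by rewrite -(ox0l 0); apply: Pox.
rewrite (tensE t); apply: big_ind => // i _; apply: big_ind => // j _.
by rewrite -oxZl; apply: Pox.
Qed.

Lemma sweedler_uniq W (F : A -> B -> W) (f : {linear tens A B -> W}) :
  (forall a b, f (a \ox b) = F a b) -> f =1 sweedler F.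
Proof.
move=> fE t; rewrite [in LHS](tensE t) linear_sum; apply: eq_bigr => i _.
by rewrite linear_sum; apply: eq_bigr => j _; rewrite linearZ /= fE.
Qed.

Definition tens_mul t s : A \ox B :=
  \sw_(a, b <- t) \sw_(a', b' <- s) (a * a') \ox (b * b').

Let mulDl : left_distributive tens_mul +%R.
Proof. by move=> t s u; rewrite /tens_mul linearD. Qed.

Let mulZl c t s : c *: tens_mul t s = tens_mul (c *: t) s.
Proof. by rewrite /tens_mul linearZ. Qed.

Lemma tens_mul_linear t : linear (tens_mul t).
Proof.
apply: (sweedler_param (F := fun s a b => sweedler _ s)) => a b c s u.
exact: linearP.
Qed.

Let mulDr : right_distributive tens_mul +%R.
Proof. by move=> t s u; have := tens_mul_linear t 1 s u; rewrite !scale1r. Qed.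

Lemma tens_mul_ox a b a' b' : tens_mul (a \ox b) (a' \ox b') = (a * a') \ox (b * b').
Proof.
rewrite /tens_mul sweedler_ox; last first.
  split=> [y|x].
    apply: (sweedler_param (F := fun x a b => (x * a) \ox (y * b))) => u v c x x'.
    by rewrite mulrDl -scalerAl !oxE.
  apply: (sweedler_param (F := fun y a b => (x * a) \ox (y * b))) => u v c y y'.
  by rewrite mulrDl -scalerAl !oxE.
by rewrite sweedler_ox //; split=> [y c x x'|x c y y'];
  rewrite mulrDr -scalerAr !oxE.
Qed.

Let mulA : associative tens_mul.
Proof.
move=> t s u; elim/tens_ind: t => [t t' IH IH'|a b]; first by rewrite !mulDl IH IH'.
elim/tens_ind: s => [s s' IH IH'|a' b']; first by rewrite mulDl !mulDr mulDl IH IH'.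
elim/tens_ind: u => [u u' IH IH'|a'' b'']; first by rewrite !mulDr IH IH'.
by rewrite !tens_mul_ox !mulrA.
Qed.

Let mul1 : left_id (1 \ox 1) tens_mul.
Proof.
by elim/tens_ind=> [t s Ht Hs|a b]; rewrite ?mulDr ?Ht ?Hs // tens_mul_ox !mul1r.
Qed.

Let mulr1' : right_id (1 \ox 1) tens_mul.
Proof.
by elim/tens_ind=> [t s Ht Hs|a b]; rewrite ?mulDl ?Ht ?Hs // tens_mul_ox !mulr1.
Qed.

Let one_neq0 : 1 \ox 1 != 0 :> A \ox B.
Proof.
have nz (V : falgType k) : exists i, v2r (1 : V) 0 i != 0.
  apply/existsP; apply: contraTT (oner_neq0 V) => /existsPn V0; rewrite negbK.
  rewrite (std_basisE 1) big1 // => i _.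
  by have := V0 i; rewrite negbK => /eqP->; rewrite scale0r.
have [[i Ai] [j Bj]] := (nz A, nz B).
apply/eqP => /matrixP/(_ i j)/eqP; rewrite !mxE big_ord1 !mxE mulf_eq0.
by rewrite (negPf Ai) (negPf Bj).
Qed.

HB.instance Definition _ := GRing.Zmodule_isNzRing.Build (tens A B)
  mulA mul1 mulr1' mulDl mulDr one_neq0.
HB.instance Definition _ := GRing.Lmodule_isLalgebra.Build k (tens A B) mulZl.

Let mulZr c t s : c *: (t * s) = t * (c *: s).
Proof.
have := tens_mul_linear t c s 0; rewrite !addr0 => H.
by rewrite [RHS]H -[tens_mul t 0]/(t * 0) mulr0 addr0.
Qed.

HB.instance Definition _ := GRing.Lalgebra_isAlgebra.Build k (tens A B) mulZr.
HB.instance Definition _ := Algebra_isFalgebra.Build k (tens A B).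

Lemma ox_mul a b a' b' : (a \ox b) * (a' \ox b') = (a * a') \ox (b * b').
Proof. exact: tens_mul_ox. Qed.

Lemma ox_one : 1 \ox 1 = 1 :> A \ox B.
Proof. by []. Qed.

End TensorTheory.

Record hopf_algebra (k : fieldType) := HopfAlgebra {
  hopf_sort :> falgType k;
  comul : {lrmorphism hopf_sort -> tens hopf_sort hopf_sort};
  counit : {lrmorphism hopf_sort -> k^o};
  antipode : {linear hopf_sort -> hopf_sort};
  antipode_inv : {linear hopf_sort -> hopf_sort};
  comulA : forall h,
    \sw_(h1, h2 <- comul h) comul h1 \ox h2 =
    \sw_(h1, h2 <- comul h) \sw_(h21, h22 <- comul h2) h1 \ox h21 \ox h22;
  counitl : forall h, \sw_(h1, h2 <- comul h) (counit h1 : k) *: h2 = h;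
  counitr : forall h, \sw_(h1, h2 <- comul h) (counit h2 : k) *: h1 = h;
  antipodel : forall h,
    \sw_(h1, h2 <- comul h) antipode h1 * h2 = (counit h : k) *: 1;
  antipoder : forall h,
    \sw_(h1, h2 <- comul h) h1 * antipode h2 = (counit h : k) *: 1;
  antipodeK : cancel antipode antipode_inv;
  antipode_invK : cancel antipode_inv antipode
}.

Record comodule_algebra (k : fieldType) (H : hopf_algebra k) := ComoduleAlgebra {
  comod_sort :> falgType k;
  coact : {lrmorphism comod_sort -> tens comod_sort H};
  coactA : forall a,
    \sw_(a0, a1 <- coact a) coact a0 \ox a1 =
    \sw_(a0, a1 <- coact a) \sw_(a11, a12 <- comul H a1) a0 \ox a11 \ox a12;
  coact_counit : forall a, \sw_(a0, a1 <- coact a) (counit H a1 : k) *: a0 = a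
}.

Section Integrals.
Variables (k : fieldType) (H : hopf_algebra k) (A : comodule_algebra H).

(* As a vector space the target A \ox H^op of an integral is A \ox H, and all *)
(* the products below are those of A and H, so the type A \ox H is used.      *)
Definition cowreath_psi (h : H) (t : A \ox H) : A \ox H \ox H :=
  \sw_(a, l <- t) \sw_(a0, a1 <- coact A a) \sw_(l1, l2 <- comul H l)
    a0 \ox l1 \ox (l2 * h * a1).

Definition is_integral (T : {linear H -> tens A H}) : Prop :=
  (forall h : H,
     \sw_(h1, h2 <- comul H h) cowreath_psi h1 (T h2) = T h \ox 1) /\
  (forall (a : A) (h : H),
     \sw_(a0, a' <- coact A a) \sw_(a1, a'' <- comul H a')
       \sw_(a2, a3 <- comul H a'')
         (a0 \ox 1) * T (antipode_inv H a2 * h * a1) * (1 \ox antipode_inv H a3)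
     = \sw_(a0, a1 <- coact A a)
         (1 \ox antipode_inv H a1) * T h * (a0 \ox 1)).

Definition total_integral (T : {linear H -> tens A H}) : Prop :=
  T 1 = 1 \ox 1.

End Integrals.

(* Cl(alpha, beta, gamma), in coordinates on the basis 1, G, X, GX; the       *)
(* presentation by generators and relations is Cl_relGX, Cl_liftG, Cl_liftX   *)
(* and Cl_lift_uniq.                                                          *)
Definition Cl (k : fieldType) (al be ga : k) : Type := 'rV[k]_4.

Local Notation "a `[ i ]" := (a 0 (@Ordinal 4 i isT))
  (at level 2, left associativity, format "a `[ i ]") : ring_scope.

Section Clifford.
Variables (k : fieldType) (al be ga : k).
Notation Cl := (Cl al be ga).

HB.instance Definition _ := Vector.copy Cl 'rV[k]_4.

Definition Cl_mk (c0 c1 c2 c3 : k) : Cl :=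
  \row_i [:: c0; c1; c2; c3]`_i.

Definition Cl_mul (a b : Cl) : Cl := Cl_mk
  (a`[0] * b`[0] + al * (a`[1] * b`[1]) + be * (a`[2] * b`[2])
     + ga * (a`[2] * b`[1]) - al * be * (a`[3] * b`[3]))
  (a`[0] * b`[1] + a`[1] * b`[0] - be * (a`[2] * b`[3])
     + ga * (a`[3] * b`[1]) + be * (a`[3] * b`[2]))
  (a`[0] * b`[2] + a`[2] * b`[0] + al * (a`[1] * b`[3])
     + ga * (a`[2] * b`[3]) - al * (a`[3] * b`[1]))
  (a`[0] * b`[3] + a`[3] * b`[0] + a`[1] * b`[2] - a`[2] * b`[1]
     + ga * (a`[3] * b`[3])).

Lemma Cl_ext (a b : Cl) :
  a`[0] = b`[0] -> a`[1] = b`[1] -> a`[2] = b`[2] -> a`[3] = b`[3] -> a = b.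
Proof.
move=> e0 e1 e2 e3; apply/rowP => -[i lti].
by case: i lti => [|[|[|[|//]]]] lti; rewrite (bool_irrelevance lti isT).
Qed.

Lemma Cl_mkE c0 c1 c2 c3 : ((Cl_mk c0 c1 c2 c3)`[0] = c0)
  * ((Cl_mk c0 c1 c2 c3)`[1] = c1) * ((Cl_mk c0 c1 c2 c3)`[2] = c2)
  * ((Cl_mk c0 c1 c2 c3)`[3] = c3).
Proof. by rewrite !mxE. Qed.

Lemma Cl_addE (a b : Cl) i : (a + b : Cl) 0 i = a 0 i + b 0 i.
Proof. exact: mxE. Qed.
Lemma Cl_oppE (a : Cl) i : (- a : Cl) 0 i = - a 0 i.
Proof. exact: mxE. Qed.
Lemma Cl_scaleE c (a : Cl) i : (c *: a : Cl) 0 i = c * a 0 i.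
Proof. exact: mxE. Qed.

Let mulA : associative Cl_mul.
Proof. by move=> a b c; apply: Cl_ext; rewrite !Cl_mkE; ring. Qed.
Let mul1 : left_id (Cl_mk 1 0 0 0) Cl_mul.
Proof. by move=> a; apply: Cl_ext; rewrite !Cl_mkE; ring. Qed.
Let mulr1' : right_id (Cl_mk 1 0 0 0) Cl_mul.
Proof. by move=> a; apply: Cl_ext; rewrite !Cl_mkE; ring. Qed.
Let mulDl : left_distributive Cl_mul +%R.
Proof. by move=> a b c; apply: Cl_ext; rewrite !(Cl_mkE, Cl_addE); ring. Qed.
Let mulDr : right_distributive Cl_mul +%R.
Proof. by move=> a b c; apply: Cl_ext; rewrite !(Cl_mkE, Cl_addE); ring. Qed.
Let one_neq0 : Cl_mk 1 0 0 0 != 0.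
Proof.
by apply/eqP => /rowP/(_ (@Ordinal 4 0 isT))/eqP; rewrite !mxE oner_eq0.
Qed.

HB.instance Definition _ :=
  GRing.Zmodule_isNzRing.Build Cl mulA mul1 mulr1' mulDl mulDr one_neq0.

Lemma Cl_mulE (a b : Cl) : a * b = Cl_mul a b. Proof. by []. Qed.
Lemma Cl_oneE : 1 = Cl_mk 1 0 0 0. Proof. by []. Qed.

Let mulZl c (a b : Cl) : c *: (a * b) = c *: a * b.
Proof.
by rewrite !Cl_mulE; apply: Cl_ext; rewrite !(Cl_mkE, Cl_scaleE); ring.
Qed.
HB.instance Definition _ := GRing.Lmodule_isLalgebra.Build k Cl mulZl.

Let mulZr c (a b : Cl) : c *: (a * b) = a * (c *: b).
Proof.
by rewrite !Cl_mulE; apply: Cl_ext; rewrite !(Cl_mkE, Cl_scaleE); ring.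
Qed.
HB.instance Definition _ := GRing.Lalgebra_isAlgebra.Build k Cl mulZr.
HB.instance Definition _ := Algebra_isFalgebra.Build k Cl.

Definition Cl_G : Cl := Cl_mk 0 1 0 0.
Definition Cl_X : Cl := Cl_mk 0 0 1 0.

Lemma Cl_basisE (a : Cl) :
  a = a`[0] *: 1 + a`[1] *: Cl_G + a`[2] *: Cl_X + a`[3] *: (Cl_G * Cl_X).
Proof.
by rewrite Cl_oneE Cl_mulE; apply: Cl_ext;
  rewrite !(Cl_mkE, Cl_addE, Cl_scaleE); ring.
Qed.

Definition Cl_rel (B : algType k) (u v : B) : Prop :=
  [/\ u * u = al%:A, v * v = be%:A & u * v + v * u = ga%:A].

Lemma Cl_relGX : Cl_rel Cl_G Cl_X.
Proof.
by split; rewrite Cl_oneE ?Cl_mulE; apply: Cl_ext;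
  rewrite ?Cl_mulE !(Cl_mkE, Cl_addE, Cl_scaleE); ring.
Qed.

Definition Cl_linear_fun (W : lmodType k) (w0 w1 w2 w3 : W) (a : Cl) : W :=
  a`[0] *: w0 + a`[1] *: w1 + a`[2] *: w2 + a`[3] *: w3.

Lemma Cl_linear_subproof (W : lmodType k) w0 w1 w2 w3 : linear (@Cl_linear_fun W w0 w1 w2 w3).
Proof.
move=> c a b; rewrite /Cl_linear_fun !(Cl_addE, Cl_scaleE) !scalerDl -!scalerA.
rewrite !scalerDr [RHS]addrACA; congr (_ + _); rewrite [RHS]addrACA.
by congr (_ + _); rewrite [RHS]addrACA.
Qed.

HB.instance Definition _ (W : lmodType k) (w0 w1 w2 w3 : W) :=
  GRing.isLinear.Build k Cl W _ (@Cl_linear_fun W w0 w1 w2 w3)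
    (@Cl_linear_subproof W w0 w1 w2 w3).

Definition Cl_linear (W : lmodType k) w0 w1 w2 w3 : {linear Cl -> W} :=
  @Cl_linear_fun W w0 w1 w2 w3.

Lemma Cl_linearE (W : lmodType k) (w0 w1 w2 w3 : W) (f := Cl_linear w0 w1 w2 w3) :
  (f 1 = w0) * (f Cl_G = w1) * (f Cl_X = w2) * (f (Cl_G * Cl_X) = w3).
Proof.
by rewrite /f /= /Cl_linear_fun Cl_oneE Cl_mulE !Cl_mkE
  !(mul0r, mulr0, mulr1, addr0, subr0, scale0r, add0r, scale1r).
Qed.

Lemma Cl_linear_ext (W : lmodType k) (f f' : Cl -> W) :
    linear f -> linear f' -> f 1 = f' 1 -> f Cl_G = f' Cl_G ->
    f Cl_X = f' Cl_X -> f (Cl_G * Cl_X) = f' (Cl_G * Cl_X) ->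
  f =1 f'.
Proof.
move=> fP f'P e1 eG eX eGX a.
pose F : {linear Cl -> W} := HB.pack f (GRing.isLinear.Build k Cl W _ f fP).
pose F' : {linear Cl -> W} := HB.pack f' (GRing.isLinear.Build k Cl W _ f' f'P).
rewrite -[f a]/(F a) -[f' a]/(F' a) (Cl_basisE a) !linearD !linearZ /=.
by rewrite e1 eG eX eGX.
Qed.

Section Lift.
Variables (B : algType k) (u v : B).

Definition Cl_lift_fun : Cl -> B := Cl_linear 1 u v (u * v).

Hypothesis uvP : Cl_rel u v.

Lemma Cl_lift_monoid : monoid_morphism Cl_lift_fun.
Proof.
have [uu vv uv_vu] := uvP; have [GG XX GX_XG] := Cl_relGX.
have vu : v * u = ga%:A - u * v by rewrite -uv_vu addrC addKr.
have XG : Cl_X * Cl_G = ga%:A - Cl_G * Cl_X by rewrite -GX_XG addrC addKr.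
rewrite /Cl_lift_fun; set f := Cl_linear _ _ _ _.
have fE := Cl_linearE 1 u v (u * v); rewrite -/f in fE.
have fZ c z : f (c *: z) = c *: f z by exact: linearZ.
have fB y z : f (y - z) = f y - f z by exact: linearB.
have Lf (z : Cl) : linear (fun b => f (z * b)).
  by move=> c y y'; rewrite mulrDr -scalerAr linearP.
have Rf (w : B) : linear (fun b => w * f b).
  by move=> c y y'; rewrite linearP mulrDr -scalerAr.
have fG : forall b, f (Cl_G * b) = u * f b.
  apply: Cl_linear_ext => //; rewrite ?mulr1 !fE ?mulr1 //.
    by rewrite GG fZ fE uu.
  by rewrite !mulrA GG uu !mulr_algl fZ fE.
have fX : forall b, f (Cl_X * b) = v * f b.
  apply: Cl_linear_ext => //; rewrite ?mulr1 !fE ?mulr1 //.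
  - by rewrite XG fB fZ !fE vu.
  - by rewrite XX fZ fE vv.
  rewrite !mulrA XG vu !mulrBl -!mulrA XX vv !mulr_algl !mulr_algr.
  by rewrite fB !fZ !fE.
split=> [|a b]; first by rewrite fE.
move: a; apply: Cl_linear_ext.
- by move=> c y y'; rewrite mulrDl -scalerAl linearP.
- by move=> c y y'; rewrite linearP mulrDl -scalerAl.
- by rewrite fE !mul1r.
- by rewrite fE fG.
- by rewrite fE fX.
- by rewrite -mulrA fG fX fE mulrA.
Qed.

HB.instance Definition _ := GRing.Linear.on Cl_lift_fun.
HB.instance Definition _ :=
  GRing.isMonoidMorphism.Build Cl B Cl_lift_fun Cl_lift_monoid.

Definition Cl_lift : {lrmorphism Cl -> B} := Cl_lift_fun.

Lemma Cl_liftG : Cl_lift Cl_G = u.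
Proof. by rewrite /= /Cl_lift_fun Cl_linearE. Qed.

Lemma Cl_liftX : Cl_lift Cl_X = v.
Proof. by rewrite /= /Cl_lift_fun Cl_linearE. Qed.

Lemma Cl_lift_uniq (f : {lrmorphism Cl -> B}) :
  f Cl_G = u -> f Cl_X = v -> f =1 Cl_lift.
Proof.
move=> fG fX; apply: Cl_linear_ext; try exact: linearP.
- by rewrite !rmorph1.
- exact: etrans fG (esym Cl_liftG).
- exact: etrans fX (esym Cl_liftX).
- have -> : f (Cl_G * Cl_X) = u * v by rewrite rmorphM /= fG fX.
  by rewrite /= /Cl_lift_fun Cl_linearE.
Qed.

End Lift.
End Clifford.

(* Sweedler's Hopf algebra is H4 = Cl(1, 0, 0), with g = G and x = X.         *)

Section Sweedler.
Variable k : fieldType.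
Local Notation H := (Cl (1 : k) 0 0).
Local Notation g := (@Cl_G k 1 0 0).
Local Notation x := (@Cl_X k 1 0 0).

Lemma H4_gg : g * g = 1.
Proof. by have [-> _ _] := Cl_relGX (1 : k) 0 0; rewrite scale1r. Qed.
Lemma H4_xx : x * x = 0.
Proof. by have [_ -> _] := Cl_relGX (1 : k) 0 0; rewrite scale0r. Qed.
Lemma H4_xg : x * g = - (g * x).
Proof.
have [_ _] := Cl_relGX (1 : k) 0 0.
by rewrite scale0r => /eqP; rewrite addrC addr_eq0 => /eqP.
Qed.

(* The relations behind the algebra map with G |-> G \ox g and               *)
(* X |-> X \ox g + 1 \ox x; for Cl = H4 it is the comultiplication.           *)
Lemma Cl_coact_rel (al be ga : k) (G := Cl_G al be ga) (X := Cl_X al be ga) :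
  Cl_rel al be ga (G \ox g) (X \ox g + 1 \ox x : Cl al be ga \ox H).
Proof.
have [GG XX GX_XG] := Cl_relGX al be ga; split.
- by rewrite ox_mul GG H4_gg oxZl ox_one.
- rewrite mulrDl !mulrDr !ox_mul XX H4_xx H4_gg H4_xg !mulr1 !mul1r !oxE.
  by rewrite ox_one addr0 -addrA subrr addr0.
- rewrite mulrDl mulrDr !ox_mul H4_gg H4_xg !mulr1 !mul1r addrACA -oxDl GX_XG.
  by rewrite -oxDr subrr !oxE addr0 ox_one.
Qed.

Definition Cl_coact (al be ga : k) :
    {lrmorphism Cl al be ga -> tens (Cl al be ga) H} :=
  Cl_lift (Cl_coact_rel al be ga).

Lemma Cl_coactE (al be ga : k) (G := Cl_G al be ga) (X := Cl_X al be ga)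
    (rho := Cl_coact al be ga) :
  (rho 1 = 1 \ox 1) * (rho G = G \ox g) * (rho X = X \ox g + 1 \ox x) *
  (rho (G * X) = (G * X) \ox 1 + G \ox (g * x)).
Proof.
have rhoG : rho G = G \ox g by rewrite /rho Cl_liftG.
have rhoX : rho X = X \ox g + 1 \ox x by rewrite /rho Cl_liftX.
do !split=> //; first by rewrite rmorph1.
by rewrite rmorphM /= rhoG rhoX mulrDr !ox_mul H4_gg mulr1.
Qed.

Lemma H4_counit_rel : Cl_rel 1 0 0 (1 : k^o) (0 : k^o).
Proof. by split; rewrite ?mulr0 ?mul0r ?addr0 ?mulr1 ?scale1r ?scale0r. Qed.

Definition H4_comul : {lrmorphism H -> tens H H} := Cl_coact 1 0 0.
Definition H4_counit : {lrmorphism H -> k^o} := Cl_lift H4_counit_rel.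

(* S is the anti-multiplicative map with S(g) = g and S(x) = gx.              *)
Definition H4_antipode : {linear H -> H} :=
  Cl_linear 1 0 0 1 g (g * x) (g * x * g).
Definition H4_antipode_inv : {linear H -> H} :=
  Cl_linear 1 0 0 1 g (x * g) (x * g * g).

Lemma sw_coact_linear (al be ga : k) (W : lmodType k) (F : Cl al be ga -> H -> W) :
  linear (fun a => sweedler F (Cl_coact al be ga a)).
Proof. by move=> c a b; rewrite !linearP. Qed.

Lemma Cl_sw_coact (al be ga : k) (W : lmodType k) (F : Cl al be ga -> H -> W)
    (G := Cl_G al be ga) (X := Cl_X al be ga)
    (f := fun a => sweedler F (Cl_coact al be ga a)) : bilin F ->
  (f 1 = F 1 1) * (f G = F G g) * (f X = F X g + F 1 x) *
  (f (G * X) = F (G * X) 1 + F G (g * x)).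
Proof. by move=> FP; rewrite /f !Cl_coactE !linearD /= !sweedler_ox. Qed.

Lemma Cl_coactA (al be ga : k) (rho := Cl_coact al be ga) a :
  \sw_(a0, a1 <- rho a) rho a0 \ox a1 =
  \sw_(a0, a1 <- rho a) \sw_(a11, a12 <- H4_comul a1) a0 \ox a11 \ox a12.
Proof.
have bl0 a0 : bilin (fun a11 a12 : H => (a0 : Cl al be ga) \ox a11 \ox a12).
  by split=> ? ? ? ?; rewrite !oxE.
have bl : bilin (fun a0 (a1 : H) => rho a0 \ox a1).
  split=> [b c a0 a0'|a0 c b b']; last by rewrite oxDr oxZr.
  by rewrite (linearP rho) oxDl oxZl.
have br : bilin (fun (a0 : Cl al be ga) a1 =>
    \sw_(a11, a12 <- H4_comul a1) a0 \ox a11 \ox a12).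
  split=> [b|b]; last exact: sw_coact_linear.
  apply: (sweedler_param (F := fun a0 a11 a12 => a0 \ox a11 \ox a12)) => u v c a0 a0'.
  by rewrite !oxE.
move: a; apply: Cl_linear_ext; [exact: sw_coact_linear|exact: sw_coact_linear| | | |].
- rewrite (Cl_sw_coact bl) (Cl_sw_coact br) (Cl_sw_coact (bl0 _)).
  by rewrite (Cl_coactE al be ga).
- rewrite (Cl_sw_coact bl) (Cl_sw_coact br) (Cl_sw_coact (bl0 _)).
  by rewrite (Cl_coactE al be ga).
- rewrite (Cl_sw_coact bl) (Cl_sw_coact br) !(Cl_sw_coact (bl0 _)).
  by rewrite !(Cl_coactE al be ga) oxDl -!addrA.
- rewrite (Cl_sw_coact bl) (Cl_sw_coact br) !(Cl_sw_coact (bl0 _)).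
  by rewrite !(Cl_coactE al be ga) oxDl -!addrA.
Qed.

Lemma H4_counitE : (H4_counit 1 = 1) * (H4_counit g = 1) * (H4_counit x = 0)
  * (H4_counit (g * x) = 0).
Proof.
have cg : H4_counit g = 1 by rewrite /H4_counit Cl_liftG.
have cx : H4_counit x = 0 by rewrite /H4_counit Cl_liftX.
do !split=> //; first exact: rmorph1.
by rewrite rmorphM /= cx mulr0.
Qed.

Lemma Cl_coact_counit (al be ga : k) a :
  \sw_(a0, a1 <- Cl_coact al be ga a) (H4_counit a1 : k) *: a0 = a.
Proof.
have bl : bilin (fun (a0 : Cl al be ga) a1 => (H4_counit a1 : k) *: a0).
  split=> [b c u v|b c u v]; first by rewrite scalerDr !scalerA mulrC.
  by rewrite linearP scalerDl scalerA.
move: a; apply: Cl_linear_ext; [exact: sw_coact_linear|by []| | | |].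
all: by rewrite Cl_sw_coact // !H4_counitE ?scale0r ?addr0 scale1r.
Qed.

Lemma H4_antipodeE (S := H4_antipode) (S' := H4_antipode_inv) :
  (S 1 = 1) * (S g = g) * (S x = g * x) * (S (g * x) = - x) *
  (S' 1 = 1) * (S' g = g) * (S' x = - (g * x)) * (S' (g * x) = x).
Proof.
rewrite /S /S' !Cl_linearE -!mulrA H4_gg !H4_xg mulrN mulrA H4_gg mul1r.
by rewrite mulr1.
Qed.

Lemma H4_counitl (h : H) :
  \sw_(h1, h2 <- H4_comul h) (H4_counit h1 : k) *: h2 = h.
Proof.
have bl : bilin (fun h1 h2 : H => (H4_counit h1 : k) *: h2).
  split=> [b c u v|b c u v]; first by rewrite linearP scalerDl scalerA.
  by rewrite scalerDr !scalerA mulrC.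
move: h; apply: Cl_linear_ext; [exact: sw_coact_linear|by []| | | |].
all: by rewrite (Cl_sw_coact bl) !H4_counitE ?scale0r ?add0r scale1r.
Qed.

Lemma H4_antipodel (h : H) :
  \sw_(h1, h2 <- H4_comul h) H4_antipode h1 * h2 = (H4_counit h : k) *: 1.
Proof.
have bl : bilin (fun h1 h2 : H => H4_antipode h1 * h2).
  split=> [b c u v|b c u v]; last by rewrite mulrDr -scalerAr.
  by rewrite linearP mulrDl -scalerAl.
move: h; apply: Cl_linear_ext; [exact: sw_coact_linear| | | | |].
- by move=> c u v; rewrite linearP scalerDl scalerA.
- by rewrite (Cl_sw_coact bl) !H4_antipodeE H4_counitE mulr1 scale1r.
- by rewrite (Cl_sw_coact bl) !H4_antipodeE H4_counitE H4_gg scale1r.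
- rewrite (Cl_sw_coact bl) !H4_antipodeE H4_counitE scale0r mul1r.
  by rewrite -mulrA H4_xg mulrN mulrA H4_gg mul1r addNr.
- rewrite (Cl_sw_coact bl) !H4_antipodeE H4_counitE scale0r mulr1.
  by rewrite mulrA H4_gg mul1r addNr.
Qed.

Lemma H4_antipoder (h : H) :
  \sw_(h1, h2 <- H4_comul h) h1 * H4_antipode h2 = (H4_counit h : k) *: 1.
Proof.
have bl : bilin (fun h1 h2 : H => h1 * H4_antipode h2).
  split=> [b c u v|b c u v]; first by rewrite mulrDl -scalerAl.
  by rewrite linearP mulrDr -scalerAr.
move: h; apply: Cl_linear_ext; [exact: sw_coact_linear| | | | |].
- by move=> c u v; rewrite linearP scalerDl scalerA.
- by rewrite (Cl_sw_coact bl) !H4_antipodeE H4_counitE mulr1 scale1r.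
- by rewrite (Cl_sw_coact bl) !H4_antipodeE H4_counitE H4_gg scale1r.
- rewrite (Cl_sw_coact bl) !H4_antipodeE H4_counitE scale0r mul1r.
  by rewrite H4_xg addNr.
- rewrite (Cl_sw_coact bl) !H4_antipodeE H4_counitE scale0r mulr1.
  by rewrite mulrN subrr.
Qed.

Lemma H4_antipodeK : cancel H4_antipode H4_antipode_inv.
Proof.
apply: Cl_linear_ext; [by move=> c u v; rewrite !linearP|by []| | | |].
- by rewrite !H4_antipodeE.
- by rewrite !H4_antipodeE.
- by rewrite !H4_antipodeE.
- by rewrite H4_antipodeE linearN H4_antipodeE opprK.
Qed.

Lemma H4_antipode_invK : cancel H4_antipode_inv H4_antipode.
Proof.
apply: Cl_linear_ext; [by move=> c u v; rewrite !linearP|by []| | | |].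
- by rewrite !H4_antipodeE.
- by rewrite !H4_antipodeE.
- by rewrite H4_antipodeE linearN H4_antipodeE opprK.
- by rewrite !H4_antipodeE.
Qed.

Definition H4 : hopf_algebra k :=
  @HopfAlgebra k H H4_comul H4_counit H4_antipode H4_antipode_inv
    (@Cl_coactA 1 0 0) H4_counitl (@Cl_coact_counit 1 0 0)
    H4_antipodel H4_antipoder H4_antipodeK H4_antipode_invK.

Definition Cl_comod (al be ga : k) : comodule_algebra H4 :=
  @ComoduleAlgebra k H4 (Cl al be ga) (Cl_coact al be ga)
    (@Cl_coactA al be ga) (@Cl_coact_counit al be ga).

End Sweedler.

Record integral_params (k : fieldType) := IntegralParams {
  pA : k; pB : k; pC : k; pD : k; pE : k; pU : k; pV : k; pZ : k
}.

Definition param_constraints (k : fieldType) (al be ga : k)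
    (p : integral_params k) : Prop :=
  [/\ pZ p * al = 0 /\ pZ p * ga = 0,
      [/\ pV p * al = 0, pV p * be = 0 & pV p * ga = 0],
      (pD p - pU p) * ga - 2 * (pC p * al) = 0 &
      2 * ((pD p - pU p) * be) - pC p * ga = 0].

Definition integral_values (k : fieldType) (al be ga : k)
    (T : {linear H4 k -> tens (Cl_comod al be ga) (H4 k)})
    (p : integral_params k) : Prop :=
  let G : Cl_comod al be ga := Cl_G al be ga in
  let X : Cl_comod al be ga := Cl_X al be ga in
  let g : H4 k := Cl_G 1 0 0 in
  let x : H4 k := Cl_X 1 0 0 in
  [/\ T 1 = pU p *: (1 \ox 1) + pV p *: ((G * X) \ox 1) + pV p *: (G \ox x),
      T g = pA p *: (1 \ox g) + pB p *: (G \ox 1) + pZ p *: ((G * X) \ox g)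
            - pZ p *: (G \ox (g * x)),
      T x = - (ga / 2 * pB p) *: (1 \ox 1) + pB p *: ((G * X) \ox 1)
            + (be * pZ p) *: (G \ox g) - pA p *: (1 \ox (g * x))
            - pZ p *: ((G * X) \ox (g * x)) &
      T (g * x) =
            pD p *: (1 \ox x) + pV p *: ((G * X) \ox x)
            + (ga / 2 * pE p) *: (1 \ox g) - pC p *: (G \ox 1)
            + (pD p - pU p) *: (X \ox 1) - pE p *: ((G * X) \ox g)
            + pE p *: (G \ox (g * x))].

(* Main.v *)
From HB Require Import structures.
Require Import Defs.
From mathcomp Require Import all_boot all_order all_algebra all_field.
From mathcomp Require Import ring.

Set Implicit Arguments.
Unset Strict Implicit.
Unset Printing Implicit Defensive.

Import GRing.Theory.
Local Open Scope ring_scope.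

(* Write an element of B \ox H4 as u0 \ox 1 + u1 \ox g + u2 \ox x + u3 \ox gx.
   Multiplication by 1 \ox g and 1 \ox x permutes the four components up to
   sign, and the coaction of Cl has four explicit components as well, so both
   integral conditions become systems of linear equations over k. The first
   condition, read at h = 1, g, x, gx in turn, leaves four free scalars for each
   of T(1), T(g), T(x), T(gx). The second one need only be imposed for a = G and
   a = X, as the case a = GX follows by multiplicativity; on these sixteen
   scalars it amounts to the relations of the theorem. *)

(** * Components of tensors along the basis 1, g, x, gx of [H] *)

Section Slots.
Variable k : fieldType.
Local Notation H := (Cl (1 : k) 0 0).
Local Notation g := (@Cl_G k 1 0 0).
Local Notation x := (@Cl_X k 1 0 0).

Lemma H4_mulE : (g * g = 1) * (x * x = 0) * (x * g = - (g * x))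
  * (g * (g * x) = x) * (g * x * g = - x) * (x * (g * x) = 0)
  * (g * x * x = 0) * (g * x * (g * x) = 0).
Proof.
have xgx : x * (g * x) = 0 by rewrite mulrA H4_xg mulNr -mulrA H4_xx mulr0 oppr0.
by rewrite !mulrA H4_gg !mul1r -!mulrA H4_xg H4_xx xgx !(mulrN, mulr0, mulrA)
  H4_gg mul1r.
Qed.

Definition slots (B : falgType k) (u0 u1 u2 u3 : B) : B \ox H :=
  u0 \ox 1 + u1 \ox g + u2 \ox x + u3 \ox (g * x).

Section Theory.
Variable B : falgType k.
Implicit Types u v w : B.

Lemma sweedler_slots (W : lmodType k) (F : B -> H -> W) u0 u1 u2 u3 : bilin F ->
  sweedler F (slots u0 u1 u2 u3) = F u0 1 + F u1 g + F u2 x + F u3 (g * x).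
Proof. by move=> FP; rewrite !linearD /= !sweedler_ox. Qed.

Lemma slots_add u0 u1 u2 u3 v0 v1 v2 v3 :
  slots u0 u1 u2 u3 + slots v0 v1 v2 v3
  = slots (u0 + v0) (u1 + v1) (u2 + v2) (u3 + v3).
Proof.
rewrite /slots !oxDl [LHS]addrACA; congr (_ + _).
by rewrite [LHS]addrACA; congr (_ + _); rewrite [LHS]addrACA.
Qed.

Lemma slots_opp u0 u1 u2 u3 :
  - slots u0 u1 u2 u3 = slots (- u0) (- u1) (- u2) (- u3).
Proof. by rewrite /slots !opprD !oxNl. Qed.

Lemma slots_surj (t : B \ox H) : exists u0 u1 u2 u3, t = slots u0 u1 u2 u3.
Proof.
elim/tens_ind: t => [t s [u0 [u1 [u2 [u3 ->]]]] [v0 [v1 [v2 [v3 ->]]]]|u h].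
  by rewrite slots_add; do 4!eexists.
rewrite (Cl_basisE h) !oxDr !oxZr -!oxZl; do 4!eexists; reflexivity.
Qed.

(** The coordinate functionals of [H], applied to the second factor, recover the components one by
    one. *)
Lemma slots_inj u0 u1 u2 u3 v0 v1 v2 v3 :
  slots u0 u1 u2 u3 = slots v0 v1 v2 v3 <->
  [/\ u0 = v0, u1 = v1, u2 = v2 & u3 = v3].
Proof.
split=> [e|[-> -> -> ->] //].
have coordP (i : 'I_4) : bilin (fun (u : B) (h : H) => (h : 'rV_4) 0 i *: u).
  split=> [b c u v|u c h h']; first by rewrite scalerDr !scalerA mulrC.
  by rewrite Cl_addE Cl_scaleE scalerDl scalerA.
have E i := congr1 (sweedler (fun (u : B) (h : H) => (h : 'rV_4) 0 i *: u)) e.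
split; [have := E (@Ordinal 4 0 isT)|have := E (@Ordinal 4 1 isT)
       |have := E (@Ordinal 4 2 isT)|have := E (@Ordinal 4 3 isT)].
all: rewrite !(sweedler_slots _ _ _ _ (coordP _)) Cl_mulE Cl_oneE /Cl_mul !Cl_mkE.
all: by rewrite !(mul0r, mulr0, mulr1, addr0, subr0, scale0r, add0r, scale1r, oppr0).
Qed.

Lemma slots_gl u0 u1 u2 u3 : (1 \ox g) * slots u0 u1 u2 u3 = slots u1 u0 u3 u2.
Proof.
rewrite /slots !mulrDr !ox_mul !mul1r !H4_mulE mulr1.
by rewrite [u0 \ox g + _]addrC -!addrA; do 2!congr (_ + _); rewrite addrC.
Qed.

Lemma slots_xl u0 u1 u2 u3 : (1 \ox x) * slots u0 u1 u2 u3 = slots 0 0 u0 (- u1).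
Proof.
by rewrite /slots !mulrDr !ox_mul !mul1r !H4_mulE !mulr1 !oxE !add0r !addr0.
Qed.

Lemma slots_gr u0 u1 u2 u3 :
  slots u0 u1 u2 u3 * (1 \ox g) = slots u1 u0 (- u3) (- u2).
Proof.
rewrite /slots !mulrDl !ox_mul !mulr1 !H4_mulE mul1r !oxE.
by rewrite [u0 \ox g + _]addrC -!addrA; do 2!congr (_ + _); rewrite addrC.
Qed.

Lemma slots_xr u0 u1 u2 u3 : slots u0 u1 u2 u3 * (1 \ox x) = slots 0 0 u0 u1.
Proof.
by rewrite /slots !mulrDl !ox_mul !mulr1 !H4_mulE !mul1r !oxE !add0r !addr0.
Qed.

Lemma slots_Al u u0 u1 u2 u3 : (u \ox 1) * slots u0 u1 u2 u3 =
  slots (u * u0) (u * u1) (u * u2) (u * u3).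
Proof. by rewrite /slots !mulrDr !ox_mul !mul1r. Qed.

Lemma slots_Ar u u0 u1 u2 u3 : slots u0 u1 u2 u3 * (u \ox 1) =
  slots (u0 * u) (u1 * u) (u2 * u) (u3 * u).
Proof. by rewrite /slots !mulrDl !ox_mul !mulr1. Qed.

Lemma slots_one u : u \ox 1 = slots u 0 0 0.
Proof. by rewrite /slots !ox0l !addr0. Qed.

Lemma slots_gxl u0 u1 u2 u3 :
  (1 \ox (g * x)) * slots u0 u1 u2 u3 = slots 0 0 (- u1) u0.
Proof.
have -> : 1 \ox (g * x) = (1 \ox g) * (1 \ox x) :> B \ox H by rewrite ox_mul mulr1.
by rewrite -mulrA slots_xl slots_gl.
Qed.

Lemma slots_gxr u0 u1 u2 u3 :
  slots u0 u1 u2 u3 * (1 \ox (g * x)) = slots 0 0 u1 u0.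
Proof.
have -> : 1 \ox (g * x) = (1 \ox g) * (1 \ox x) :> B \ox H by rewrite ox_mul mulr1.
by rewrite mulrA slots_gr slots_xr.
Qed.

(** This is the form of the second integral condition at a = G: u is G, t holds the components of
    T(h) and s those of T(ghg). *)
Lemma slots_G_condition u s0 s1 s2 s3 t0 t1 t2 t3 :
  (u \ox 1) * slots s0 s1 s2 s3 * (1 \ox g) = (1 \ox g) * slots t0 t1 t2 t3 * (u \ox 1) <->
  [/\ u * s1 = t1 * u, u * s0 = t0 * u, - (u * s3) = t3 * u & - (u * s2) = t2 * u].
Proof. by rewrite slots_Al slots_gr slots_gl slots_Ar slots_inj. Qed.

(** The analogue at a = X: here u is X, and p holds the components of T(ghx - gxh). *)
Lemma slots_X_condition u s0 s1 s2 s3 t0 t1 t2 t3 p0 p1 p2 p3 :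
  (u \ox 1) * slots s0 s1 s2 s3 * (1 \ox g) + slots p0 p1 p2 p3 * (1 \ox g)
    - slots t0 t1 t2 t3 * (1 \ox (g * x))
  = (1 \ox g) * slots t0 t1 t2 t3 * (u \ox 1) - (1 \ox (g * x)) * slots t0 t1 t2 t3 <->
  [/\ u * s1 + p1 = t1 * u, u * s0 + p0 = t0 * u,
      - (u * s3) - p3 - t1 = t3 * u + t1 & - (u * s2) - p2 - t0 = t2 * u - t0].
Proof.
rewrite slots_Al !slots_gr slots_gl slots_gxr slots_gxl slots_Ar !slots_opp !slots_add.
by rewrite slots_inj !oppr0 !addr0 opprK.
Qed.

Section Values.
Variables e a b c : B.

(** This lemma and the next three sort the values in the theorem by components; e, a, b, c stand for
    1, G, X, GX. *)
Lemma slots_value1 (U V : k) : U *: (e \ox 1) + V *: (c \ox 1) + V *: (a \ox x) =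
  slots (U *: e + V *: c) 0 (V *: a) 0 :> B \ox H.
Proof. by rewrite /slots !oxDl !oxZl !ox0l !addr0. Qed.

Lemma slots_valueg (P Q Z : k) :
  P *: (e \ox g) + Q *: (a \ox 1) + Z *: (c \ox g) - Z *: (a \ox (g * x)) =
  slots (Q *: a) (P *: e + Z *: c) 0 (- (Z *: a)).
Proof.
rewrite /slots !oxDl !oxNl !oxZl !ox0l !addr0; congr (_ - _).
by rewrite -addrA addrCA.
Qed.

Lemma slots_valuex (P Q R S Z : k) :
  P *: (e \ox 1) + Q *: (c \ox 1) + R *: (a \ox g) - S *: (e \ox (g * x))
    - Z *: (c \ox (g * x)) =
  slots (P *: e + Q *: c) (R *: a) 0 (- (S *: e) - Z *: c).
Proof. by rewrite /slots !oxDl !oxNl !oxZl !ox0l !addr0 addrA. Qed.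

Lemma slots_valuegx (P V Q C D E : k) :
  P *: (e \ox x) + V *: (c \ox x) + Q *: (e \ox g) - C *: (a \ox 1) + D *: (b \ox 1)
    - E *: (c \ox g) + E *: (a \ox (g * x)) =
  slots (- (C *: a) + D *: b) (Q *: e - E *: c) (P *: e + V *: c) (E *: a).
Proof.
by rewrite /slots !oxDl !oxNl !oxZl [LHS](ACl ((4*5)*(3*6)*(1*2)*7))%AC.
Qed.

End Values.
End Theory.
End Slots.

(** The first summand has the shape of ψ at x or gx, where every inner component along 1 and g
    vanishes. *)
Lemma slots2_addr (k : fieldType) (B : falgType k) (a02 a03 a12 a13 a22 a23 a32 a33
    b00 b01 b02 b03 b10 b11 b12 b13 b20 b21 b22 b23 b30 b31 b32 b33 : B) :
  slots (slots 0 0 a02 a03) (slots 0 0 a12 a13)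
    (slots 0 0 a22 a23) (slots 0 0 a32 a33) +
  slots (slots b00 b01 b02 b03) (slots b10 b11 b12 b13)
    (slots b20 b21 b22 b23) (slots b30 b31 b32 b33) =
  slots (slots b00 b01 (a02 + b02) (a03 + b03))
    (slots b10 b11 (a12 + b12) (a13 + b13))
    (slots b20 b21 (a22 + b22) (a23 + b23))
    (slots b30 b31 (a32 + b32) (a33 + b33)).
Proof. by rewrite !slots_add !add0r. Qed.

(** Used in ψ to expand Δ(l) before ρ(a), since l runs through the basis while a stays arbitrary. *)
Lemma exchange_sweedler (k : fieldType) (A B C D : falgType k) (W : lmodType k)
    (F : A -> B -> C -> D -> W) (t : A \ox B) (s : C \ox D) :
  \sw_(a, b <- t) \sw_(c, d <- s) F a b c d
  = \sw_(c, d <- s) \sw_(a, b <- t) F a b c d.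
Proof.
rewrite /sweedler !pair_big /=.
under eq_bigr do rewrite pair_big scaler_sumr.
under [RHS]eq_bigr do rewrite pair_big scaler_sumr.
rewrite exchange_big; apply: eq_bigr => p _; apply: eq_bigr => q _ /=.
by rewrite !scalerA mulrC.
Qed.

(** * Linearity in h of the two sides of the second condition *)

Section LinearMaps.
Variables (k : fieldType) (V : lmodType k) (R : algType k).

Lemma linear_mul2 (a b : R) (f : V -> R) : linear f -> linear (fun v => a * f v * b).
Proof. by move=> fP c u v; rewrite fP mulrDr mulrDl -scalerAr -scalerAl. Qed.

Lemma linear_mulr (b : R) (f : V -> R) : linear f -> linear (fun v => f v * b).
Proof. by move=> fP c u v; rewrite fP mulrDl -scalerAl. Qed.

Lemma linear_mull (a : R) (f : V -> R) : linear f -> linear (fun v => a * f v).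
Proof. by move=> fP c u v; rewrite fP mulrDr -scalerAr. Qed.

Lemma linear_add (f f' : V -> R) : linear f -> linear f' -> linear (fun v => f v + f' v).
Proof. by move=> fP fP' c u v; rewrite fP fP' scalerDr addrACA. Qed.

Lemma linear_sub (f f' : V -> R) : linear f -> linear f' -> linear (fun v => f v - f' v).
Proof. by move=> fP fP' c u v; rewrite fP fP' scalerBr opprD addrACA. Qed.

Lemma linear_comp (U : lmodType k) (h : U -> V) (f : {linear V -> R}) :
  linear h -> linear (fun u => f (h u)).
Proof. by move=> hP c u v; rewrite hP linearP. Qed.

End LinearMaps.

(** * Exchange of the last two tensor factors *)

Section Swap.
Variable k : fieldType.
Local Notation H := (H4 k).

(* [cowreath_psi] leaves the comultiplied factor l1 in the middle, while [slots]
   expands the last factor; swapping the two makes them match. *)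
Definition swap_tens (B : falgType k) (t : B \ox H \ox H) : B \ox H \ox H :=
  \sw_(s, c <- t) \sw_(b, h <- s) b \ox c \ox h.

Section SwapTheory.
Variable B : falgType k.

Lemma swap_tens_linear : linear (@swap_tens B).
Proof. exact: sweedler_linear. Qed.
HB.instance Definition _ := GRing.isLinear.Build k (tens (tens B H) H)
  (tens (tens B H) H) _ (@swap_tens B) swap_tens_linear.

Lemma swap_tensD (t s : B \ox H \ox H) :
  swap_tens (t + s) = swap_tens t + swap_tens s.
Proof. exact: raddfD. Qed.

Lemma swap_tens_ox (b : B) (h c : H) : swap_tens (b \ox h \ox c) = b \ox c \ox h.
Proof.
rewrite /swap_tens sweedler_ox ?sweedler_ox //.
- by split=> ? ? ? ?; rewrite !oxE.
- split=> [c'|s]; first exact: sweedler_linear.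
  by apply: (sweedler_param (F := fun c b h => b \ox c \ox h)) => ? ? ? ? ?; rewrite !oxE.
Qed.

Lemma swap_tensK : involutive (@swap_tens B).
Proof.
elim/tens_ind=> [t s Ht Hs|s c]; first by rewrite !linearD /= Ht Hs.
elim/tens_ind: s => [s s' Hs Hs'|b h]; first by rewrite oxDl !linearD /= Hs Hs'.
by rewrite !swap_tens_ox.
Qed.

(** For a fixed term of Δ(l), the sum over ρ(a) in ψ thus becomes left multiplication of ρ(a) by 1 ⊗
    l2 h, with l1 outermost. *)
Lemma swap_tens_mid (s : B \ox H) (h l : H) :
  swap_tens (\sw_(b, c <- s) b \ox l \ox (h * c)) = ((1 \ox h) * s) \ox l.
Proof.
elim/tens_ind: s => [s s' Hs Hs'|b c].
  by rewrite !linearD /= Hs Hs' mulrDr oxDl.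
rewrite sweedler_ox ?swap_tens_ox ?ox_mul ?mul1r //.
by split=> [c' a b1 b2|b1 a c1 c2]; rewrite ?mulrDr -?scalerAr !oxE.
Qed.

Lemma swap_inj : injective (@swap_tens B).
Proof. exact: inv_inj swap_tensK. Qed.

Lemma swap_tensP (s t : B \ox H \ox H) : s = t <-> swap_tens s = swap_tens t.
Proof. by split=> [->|/swap_inj]. Qed.

Lemma swap_slots_one (u0 u1 u2 u3 : B) : swap_tens (slots u0 u1 u2 u3 \ox 1) =
  slots (u0 \ox 1) (u1 \ox 1) (u2 \ox 1) (u3 \ox 1).
Proof. by rewrite /slots !oxDl !swap_tensD !swap_tens_ox. Qed.

End SwapTheory.
End Swap.

(** * Coordinate formulas in Cl(α, β, γ) *)

Section CliffordCoordinates.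
Variables (k : fieldType) (al be ga : k).
Local Notation mk := (Cl_mk al be ga).

Lemma Cl_mk_surj (u : Cl al be ga) : exists a0 a1 a2 a3, u = mk a0 a1 a2 a3.
Proof. by do 4!eexists; apply: Cl_ext; rewrite !Cl_mkE; reflexivity. Qed.

Lemma Cl_mk_inj a0 a1 a2 a3 b0 b1 b2 b3 : mk a0 a1 a2 a3 = mk b0 b1 b2 b3 <->
  [/\ a0 = b0, a1 = b1, a2 = b2 & a3 = b3].
Proof.
split=> [e|[-> -> -> ->] //].
have E i := congr1 (fun u : 'rV[k]_4 => u 0 i) e.
by split; [have := E (@Ordinal 4 0 isT)|have := E (@Ordinal 4 1 isT)
  |have := E (@Ordinal 4 2 isT)|have := E (@Ordinal 4 3 isT)]; rewrite !mxE.
Qed.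

Lemma Cl_mk0 : mk 0 0 0 0 = 0.
Proof. by apply: Cl_ext; rewrite !Cl_mkE mxE. Qed.

Lemma Cl_mkD a0 a1 a2 a3 b0 b1 b2 b3 :
  mk a0 a1 a2 a3 + mk b0 b1 b2 b3 = mk (a0 + b0) (a1 + b1) (a2 + b2) (a3 + b3).
Proof. by apply: Cl_ext; rewrite !(Cl_addE, Cl_mkE). Qed.

Lemma Cl_mkN a0 a1 a2 a3 : - mk a0 a1 a2 a3 = mk (- a0) (- a1) (- a2) (- a3).
Proof. by apply: Cl_ext; rewrite !(Cl_oppE, Cl_mkE). Qed.

Lemma Cl_mkZ c a0 a1 a2 a3 : c *: mk a0 a1 a2 a3 = mk (c * a0) (c * a1) (c * a2) (c * a3).
Proof. by apply: Cl_ext; rewrite !(Cl_scaleE, Cl_mkE). Qed.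

Lemma mulG_mk a0 a1 a2 a3 : Cl_G al be ga * mk a0 a1 a2 a3 = mk (al * a1) a0 (al * a3) a2.
Proof. by rewrite Cl_mulE; apply: Cl_ext; rewrite !Cl_mkE; ring. Qed.

Lemma mulX_mk a0 a1 a2 a3 : Cl_X al be ga * mk a0 a1 a2 a3 =
  mk (be * a2 + ga * a1) (- (be * a3)) (a0 + ga * a3) (- a1).
Proof. by rewrite Cl_mulE; apply: Cl_ext; rewrite !Cl_mkE; ring. Qed.

Lemma mk_mulG a0 a1 a2 a3 : mk a0 a1 a2 a3 * Cl_G al be ga =
  mk (al * a1 + ga * a2) (a0 + ga * a3) (- (al * a3)) (- a2).
Proof. by rewrite Cl_mulE; apply: Cl_ext; rewrite !Cl_mkE; ring. Qed.

Lemma mk_mulX a0 a1 a2 a3 : mk a0 a1 a2 a3 * Cl_X al be ga =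
  mk (be * a2) (be * a3) a0 a1.
Proof. by rewrite Cl_mulE; apply: Cl_ext; rewrite !Cl_mkE; ring. Qed.

End CliffordCoordinates.

(** * The coaction followed by two comultiplications *)

Section IteratedCoaction.
Variables (k : fieldType) (al be ga : k) (W : lmodType k).
Local Notation A := (Cl_comod al be ga).
Local Notation H := (H4 k).
Local Notation G := (Cl_G al be ga : A).
Local Notation X := (Cl_X al be ga : A).
Local Notation g := (@Cl_G k 1 0 0 : H).
Local Notation x := (@Cl_X k 1 0 0 : H).
Variable F : A -> H -> H -> H -> W.
Hypothesis F0 : forall h1 h2 h3, linear (fun a => F a h1 h2 h3).
Hypothesis F1 : forall a h2 h3, linear (fun h1 => F a h1 h2 h3).
Hypothesis F2 : forall a h1 h3, linear (fun h2 => F a h1 h2 h3).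
Hypothesis F3 : forall a h1 h2, linear (F a h1 h2).

Let sw3 (a : A) : W := \sw_(a0, a' <- coact A a) \sw_(a1, a'' <- comul H a')
  \sw_(a2, a3 <- comul H a'') F a0 a1 a2 a3.

(** As g is group-like, G only acquires factors g. As Δ(x) = x ⊗ g + 1 ⊗ x, X gives the term with g
    in all three places and one term for each place of x, with 1 to its left and g to its right; GX
    is similar. Linearity in each argument is what allows the nested coordinate sums to be evaluated
    on pure tensors. *)
Lemma sw_coact3 :
  (sw3 1 = F 1 1 1 1) * (sw3 G = F G g g g) *
  (sw3 X = F X g g g + (F 1 x g g + (F 1 1 x g + F 1 1 1 x))) *
  (sw3 (G * X) = F (G * X) 1 1 1 + (F G (g * x) 1 1 +
     (F G g (g * x) 1 + F G g g (g * x)))).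
Proof.
have bl2 a0 a1 : bilin (F a0 a1) by split=> [a3|a2]; [exact: F2|exact: F3].
have bl1 a0 : bilin (fun a1 a'' => \sw_(a2, a3 <- comul H a'') F a0 a1 a2 a3).
  split=> [a''|a1]; last exact: sw_coact_linear.
  by apply: (sweedler_param (F := F a0)) => *; apply: F1.
have bl0 : bilin (fun a0 a' => \sw_(a1, a'' <- comul H a')
    \sw_(a2, a3 <- comul H a'') F a0 a1 a2 a3).
  split=> [a'|a0]; last exact: sw_coact_linear.
  apply: (sweedler_param (F := fun a0 a1 a'' =>
    \sw_(a2, a3 <- comul H a'') F a0 a1 a2 a3)) => a1 a''.
  by apply: (sweedler_param (F := fun a0 => F a0 a1)) => *; apply: F0.
by rewrite /sw3 !(Cl_sw_coact bl0) !(Cl_sw_coact (bl1 _)) !(Cl_sw_coact (bl2 _ _)).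
Qed.

End IteratedCoaction.

(* Multiply the second relation by a on the left and by g on the right, and
   move a across u by means of the first one. *)
Lemma twisted_module_mul (R : pzRingType) (a b g x y t u p q : R) :
  g * g = 1 -> y * g = - x -> a * g = g * a -> b * g = g * b -> a * y = y * a ->
  a * u * g = g * t * a ->
  b * t * g + p * g + q * g - u * y = g * u * b - y * u ->
  a * b * t + a * p + a * q + a * u * x = t * (a * b) + x * t * a.
Proof.
move=> gg yg ag bg ay Pa Pb.
have gK z : z * g * g = z by rewrite -mulrA gg mulr1.
have := congr1 (fun z => a * z * g) Pb.
rewrite !(mulrDr, mulrDl, mulrN, mulNr) !mulrA !gK -(mulrA _ y g) yg mulrN opprK.
move=> ->; rewrite ag ay -(mulrA _ b g) bg.
have -> : g * a * u * (g * b) = g * (a * u * g) * b by rewrite !mulrA.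
have -> : y * a * u * g = y * (a * u * g) by rewrite !mulrA.
by rewrite Pa !mulrA gg mul1r yg !mulNr opprK.
Qed.

(** * The cowreath map ψ of Cl(α, β, γ) in components *)

Section CliffordIntegrals.
Variables (k : fieldType) (al be ga : k).
Local Notation A := (Cl_comod al be ga).
Local Notation H := (H4 k).
Local Notation G := (Cl_G al be ga : A).
Local Notation X := (Cl_X al be ga : A).
Local Notation g := (@Cl_G k 1 0 0 : H).
Local Notation x := (@Cl_X k 1 0 0 : H).
Local Notation mk := (Cl_mk al be ga : k -> k -> k -> k -> A).

(** The coordinate rules are restated at the carrier [A] of the comodule algebra, where the
    operations of the integral conditions live. *)
Let mk0 : mk 0 0 0 0 = 0. Proof. exact: Cl_mk0. Qed.
Let mkN a0 a1 a2 a3 : - mk a0 a1 a2 a3 = mk (- a0) (- a1) (- a2) (- a3).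
Proof. exact: Cl_mkN. Qed.
Let mkD a0 a1 a2 a3 b0 b1 b2 b3 :
  mk a0 a1 a2 a3 + mk b0 b1 b2 b3 = mk (a0 + b0) (a1 + b1) (a2 + b2) (a3 + b3).
Proof. exact: Cl_mkD. Qed.
Let mulG a0 a1 a2 a3 : G * mk a0 a1 a2 a3 = mk (al * a1) a0 (al * a3) a2.
Proof. exact: mulG_mk. Qed.
Let mulX a0 a1 a2 a3 : X * mk a0 a1 a2 a3 =
  mk (be * a2 + ga * a1) (- (be * a3)) (a0 + ga * a3) (- a1).
Proof. exact: mulX_mk. Qed.
Let mulrG a0 a1 a2 a3 : mk a0 a1 a2 a3 * G =
  mk (al * a1 + ga * a2) (a0 + ga * a3) (- (al * a3)) (- a2).
Proof. exact: mk_mulG. Qed.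
Let mulrX a0 a1 a2 a3 : mk a0 a1 a2 a3 * X = mk (be * a2) (be * a3) a0 a1.
Proof. exact: mk_mulX. Qed.
Let mkZ c a0 a1 a2 a3 : c *: mk a0 a1 a2 a3 = mk (c * a0) (c * a1) (c * a2) (c * a3).
Proof. exact: Cl_mkZ. Qed.
Let mk1 : 1 = mk 1 0 0 0. Proof. by []. Qed.
Let mkG : G = mk 0 1 0 0. Proof. by []. Qed.
Let mkX : X = mk 0 0 1 0. Proof. by []. Qed.
Let mkGX : G * X = mk 0 0 0 1. Proof. by rewrite mkX mulG !mulr0. Qed.

Lemma coact_mk a0 a1 a2 a3 : coact A (mk a0 a1 a2 a3) =
  slots (mk a0 0 0 a3) (mk 0 a1 a2 0) (mk a2 0 0 0) (mk 0 a3 0 0) :> A \ox H.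
Proof.
have mkE b0 b1 b2 b3 : mk b0 b1 b2 b3 = b0 *: 1 + b1 *: G + b2 *: X + b3 *: (G * X).
  by rewrite [LHS]Cl_basisE !Cl_mkE.
rewrite /slots !mkE !scale0r !(addr0, add0r) !(linearD, linearZ) /=.
rewrite !(Cl_coactE al be ga) !oxE !scalerDr.
rewrite -!addrA; congr (_ + _); do 2!(rewrite [RHS]addrCA; congr (_ + _)).
by rewrite [RHS]addrCA.
Qed.

Lemma psi_bilin : bilin (@cowreath_psi k H A).
Proof.
split=> [t|h]; last exact: sweedler_linear.
apply: (sweedler_param (F := fun h a l => \sw_(a0, a1 <- coact A a)
  \sw_(l1, l2 <- comul H l) a0 \ox l1 \ox (l2 * h * a1))) => a l.
apply: (sweedler_param (F := fun h a0 a1 =>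
  \sw_(l1, l2 <- comul H l) a0 \ox l1 \ox (l2 * h * a1))) => a0 a1.
apply: (sweedler_param (F := fun h l1 l2 => a0 \ox l1 \ox (l2 * h * a1))).
move=> l1 l2 c h h'.
by rewrite mulrDr mulrDl -scalerAr -scalerAl !oxE.
Qed.

HB.instance Definition _ (h : H) := GRing.isLinear.Build k (tens A H)
  (tens (tens A H) H) _ (@cowreath_psi k H A h) (psi_bilin.2 h).

Lemma psiD (h : H) (t s : A \ox H) :
  cowreath_psi h (t + s) = cowreath_psi h t + cowreath_psi h s.
Proof. exact: raddfD. Qed.

Lemma psi_ox (h : H) (u : A) (l : H) : cowreath_psi h (u \ox l) =
  \sw_(l1, l2 <- comul H l) \sw_(a0, a1 <- coact A u) a0 \ox l1 \ox (l2 * h * a1).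
Proof.
rewrite exchange_sweedler /cowreath_psi sweedler_ox //.
split=> [l' c v v'|v c l' l'']; first by rewrite !linearP.
move: c l' l''; apply: (sweedler_param (F := fun l' a0 a1 =>
  \sw_(l1, l2 <- comul H l') a0 \ox l1 \ox (l2 * h * a1))) => a0 a1.
by move=> c l' l''; rewrite !linearP.
Qed.

(** The outer component records the first leg of Δ(l), and the second leg multiplies h. Since Δ(x) =
    x ⊗ g + 1 ⊗ x and Δ(gx) = gx ⊗ 1 + g ⊗ gx, the component u2 feeds the places of 1 and x, and u3
    those of g and gx. *)
Lemma swap_psi_slots (h : H) (u0 u1 u2 u3 : A) :
  swap_tens (cowreath_psi h (slots u0 u1 u2 u3)) =
  slots ((1 \ox h) * coact A u0 + (1 \ox (x * h)) * coact A u2)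
        ((1 \ox (g * h)) * coact A u1 + (1 \ox (g * x * h)) * coact A u3)
        ((1 \ox (g * h)) * coact A u2)
        ((1 \ox h) * coact A u3).
Proof.
have rhs_bilin u : bilin (fun l1 l2 : H =>
    \sw_(a0, a1 <- coact A u) a0 \ox l1 \ox (l2 * h * a1)).
  split=> [l2|l1].
    apply: (sweedler_param (F := fun l1 a0 a1 => a0 \ox l1 \ox (l2 * h * a1))).
    by move=> a0 a1 c l l'; rewrite !oxE.
  apply: (sweedler_param (F := fun l2 a0 a1 => a0 \ox l1 \ox (l2 * h * a1))).
  by move=> a0 a1 c l l'; rewrite !mulrDl -!scalerAl !oxE.
have swE u := Cl_sw_coact (rhs_bilin u).
rewrite /slots !psiD !psi_ox !swE !swap_tensD !swap_tens_mid !mul1r !oxDl.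
rewrite -!addrA; congr (_ + _); rewrite [RHS]addrCA; congr (_ + _).
rewrite [LHS]addrCA [in RHS](addrCA (_ \ox g)); congr (_ + _).
by congr (_ + _); rewrite addrC.
Qed.

(* The components of the coaction stay abstract here: with explicit ones the
   unifier unfolds matrices when matching sums. *)
Section Components.
Variables (p0 p1 p2 p3 : A -> A).
Hypothesis rhoE : forall u, coact A u = slots (p0 u) (p1 u) (p2 u) (p3 u).
Implicit Types u v : A.

Lemma swap_psi_1 u0 u1 u2 u3 : swap_tens (cowreath_psi 1 (slots u0 u1 u2 u3)) = slots
  (slots (p0 u0) (p1 u0) (p2 u0 + p0 u2) (p3 u0 - p1 u2))
  (slots (p1 u1) (p0 u1) (p3 u1 - p1 u3) (p2 u1 + p0 u3))
  (slots (p1 u2) (p0 u2) (p3 u2) (p2 u2))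
  (slots (p0 u3) (p1 u3) (p2 u3) (p3 u3)).
Proof.
rewrite swap_psi_slots !rhoE !mulr1 ox_one !mul1r !slots_gl slots_xl slots_gxl.
by rewrite !slots_add !addr0.
Qed.

Lemma swap_psi_g u0 u1 u2 u3 : swap_tens (cowreath_psi g (slots u0 u1 u2 u3)) = slots
  (slots (p1 u0) (p0 u0) (p3 u0 + p1 u2) (p2 u0 - p0 u2))
  (slots (p0 u1) (p1 u1) (p2 u1 - p0 u3) (p3 u1 + p1 u3))
  (slots (p0 u2) (p1 u2) (p2 u2) (p3 u2))
  (slots (p1 u3) (p0 u3) (p3 u3) (p2 u3)).
Proof.
rewrite swap_psi_slots !rhoE.
have [-> -> ->] : [/\ g * g = 1, x * g = - (g * x) & g * x * g = - x].
  by rewrite !H4_mulE.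
rewrite ox_one !mul1r !oxNr !mulNr !slots_gl.
by rewrite slots_xl slots_gxl !slots_opp !opprK !slots_add !oppr0 !addr0.
Qed.

Lemma swap_psi_x u0 u1 u2 u3 : swap_tens (cowreath_psi x (slots u0 u1 u2 u3)) = slots
  (slots 0 0 (p0 u0) (- p1 u0)) (slots 0 0 (- p1 u1) (p0 u1))
  (slots 0 0 (- p1 u2) (p0 u2)) (slots 0 0 (p0 u3) (- p1 u3)).
Proof.
rewrite swap_psi_slots !rhoE.
have [-> ->] : x * x = 0 /\ g * x * x = 0 by rewrite !H4_mulE.
by rewrite !ox0r !mul0r !addr0 !slots_xl !slots_gxl.
Qed.

Lemma swap_psi_gx u0 u1 u2 u3 :
  swap_tens (cowreath_psi (g * x) (slots u0 u1 u2 u3)) = slots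
  (slots 0 0 (- p1 u0) (p0 u0)) (slots 0 0 (p0 u1) (- p1 u1))
  (slots 0 0 (p0 u2) (- p1 u2)) (slots 0 0 (- p1 u3) (p0 u3)).
Proof.
rewrite swap_psi_slots !rhoE.
have [-> -> ->] : [/\ g * (g * x) = x, x * (g * x) = 0 & g * x * (g * x) = 0].
  by rewrite !H4_mulE.
by rewrite !ox0r !mul0r !addr0 !slots_xl !slots_gxl.
Qed.

(** The left side of the first condition at h = x: by the formula for Δ(x), u holds the components
    of T(g) and v those of T(x). *)
Lemma swap_psi_x1 u0 u1 u2 u3 v0 v1 v2 v3 :
  swap_tens (cowreath_psi x (slots u0 u1 u2 u3) +
             cowreath_psi 1 (slots v0 v1 v2 v3)) = slots
  (slots (p0 v0) (p1 v0) (p0 u0 + (p2 v0 + p0 v2)) (- p1 u0 + (p3 v0 - p1 v2)))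
  (slots (p1 v1) (p0 v1) (- p1 u1 + (p3 v1 - p1 v3)) (p0 u1 + (p2 v1 + p0 v3)))
  (slots (p1 v2) (p0 v2) (- p1 u2 + p3 v2) (p0 u2 + p2 v2))
  (slots (p0 v3) (p1 v3) (p0 u3 + p2 v3) (- p1 u3 + p3 v3)).
Proof.
rewrite swap_tensD (f_equal2 +%R (swap_psi_x u0 u1 u2 u3) (swap_psi_1 v0 v1 v2 v3)).
exact: slots2_addr.
Qed.

(** The left side of the first condition at h = gx: by the formula for Δ(gx), u holds the components
    of T(1) and v those of T(gx). *)
Lemma swap_psi_gxg u0 u1 u2 u3 v0 v1 v2 v3 :
  swap_tens (cowreath_psi (g * x) (slots u0 u1 u2 u3) +
             cowreath_psi g (slots v0 v1 v2 v3)) = slots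
  (slots (p1 v0) (p0 v0) (- p1 u0 + (p3 v0 + p1 v2)) (p0 u0 + (p2 v0 - p0 v2)))
  (slots (p0 v1) (p1 v1) (p0 u1 + (p2 v1 - p0 v3)) (- p1 u1 + (p3 v1 + p1 v3)))
  (slots (p0 v2) (p1 v2) (p0 u2 + p2 v2) (- p1 u2 + p3 v2))
  (slots (p1 v3) (p0 v3) (- p1 u3 + p3 v3) (p0 u3 + p2 v3)).
Proof.
rewrite swap_tensD (f_equal2 +%R (swap_psi_gx u0 u1 u2 u3) (swap_psi_g v0 v1 v2 v3)).
exact: slots2_addr.
Qed.

End Components.

(** * Solution of the first condition at 1, g, x, gx *)

Definition coact0 (u : A) : A :=
  mk ((u : 'rV_4) 0 (@Ordinal 4 0 isT)) 0 0 ((u : 'rV_4) 0 (@Ordinal 4 3 isT)).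
Definition coact1 (u : A) : A :=
  mk 0 ((u : 'rV_4) 0 (@Ordinal 4 1 isT)) ((u : 'rV_4) 0 (@Ordinal 4 2 isT)) 0.
Definition coact2 (u : A) : A := mk ((u : 'rV_4) 0 (@Ordinal 4 2 isT)) 0 0 0.
Definition coact3 (u : A) : A := mk 0 ((u : 'rV_4) 0 (@Ordinal 4 3 isT)) 0 0.

Lemma coact_component_mk a0 a1 a2 a3 (u := mk a0 a1 a2 a3) :
  (coact0 u = mk a0 0 0 a3) * (coact1 u = mk 0 a1 a2 0) *
  (coact2 u = mk a2 0 0 0) * (coact3 u = mk 0 a3 0 0).
Proof. by rewrite /coact0 /coact1 /coact2 /coact3 !Cl_mkE. Qed.

Lemma coact_slots u :
  coact A u = slots (coact0 u) (coact1 u) (coact2 u) (coact3 u).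
Proof.
have [a0 [a1 [a2 [a3 ->]]]] := Cl_mk_surj u.
by rewrite !coact_component_mk coact_mk.
Qed.

Lemma A_mk_surj (u : A) : exists a0 a1 a2 a3, u = mk a0 a1 a2 a3.
Proof. exact: Cl_mk_surj. Qed.

(** After the swap, the outer components are compared with u0 ⊗ 1, ..., u3 ⊗ 1. Their inner
    components along 1 and g leave u0 and u3 only the coordinates on 1 and GX, and u1 and u2 only
    those on G and X; the inner components along x and gx kill or link what remains. *)
Lemma psi_1P (t : A \ox H) : cowreath_psi 1 t = t \ox 1 <->
  exists a b c d, t = slots (mk a 0 0 b) (mk 0 d (- c) 0) (mk 0 b 0 0) (mk c 0 0 0).
Proof.
split=> [|[a [b [c [d ->]]]]]; rewrite swap_tensP; last first.
  rewrite (swap_psi_1 coact_slots) swap_slots_one !slots_one -mk0.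
  rewrite !coact_component_mk !mkN !mkD.
  by apply/slots_inj; split; apply/slots_inj; split; apply/Cl_mk_inj; split; ring.
have [u0 [u1 [u2 [u3 ->]]]] := slots_surj t.
have [a0 [a1 [a2 [a3 ->]]]] := A_mk_surj u0.
have [b0 [b1 [b2 [b3 ->]]]] := A_mk_surj u1.
have [c0 [c1 [c2 [c3 ->]]]] := A_mk_surj u2.
have [d0 [d1 [d2 [d3 ->]]]] := A_mk_surj u3.
rewrite (swap_psi_1 coact_slots) swap_slots_one !slots_one -mk0.
rewrite !coact_component_mk !mkN !mkD.
(* One line for each outer component, along 1, g, x, gx. *)
case/slots_inj=> /slots_inj[_ /Cl_mk_inj[_ -> -> _] _ /Cl_mk_inj[_ /subr0_eq-> _ _]].
case/slots_inj=> /Cl_mk_inj[<- _ _ <-] _ _ /Cl_mk_inj[/addr0_eq <- _ _ _].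
case/slots_inj=> /Cl_mk_inj[<- _ _ <-] _ _ /Cl_mk_inj[-> _ _ _].
case/slots_inj=> /Cl_mk_inj[_ <- <- _] _ _ /Cl_mk_inj[_ -> _ _].
by exists a0, c1, (- b2), b1; rewrite opprK.
Qed.

Lemma psi_gP (t : A \ox H) : cowreath_psi g t = t \ox 1 <->
  exists a b c d, t = slots (mk 0 d c 0) (mk a 0 0 (- b)) (mk c 0 0 0) (mk 0 b 0 0).
Proof.
split=> [|[a [b [c [d ->]]]]]; rewrite swap_tensP; last first.
  rewrite (swap_psi_g coact_slots) swap_slots_one !slots_one -mk0.
  rewrite !coact_component_mk !mkN !mkD.
  by apply/slots_inj; split; apply/slots_inj; split; apply/Cl_mk_inj; split; ring.
have [u0 [u1 [u2 [u3 ->]]]] := slots_surj t.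
have [a0 [a1 [a2 [a3 ->]]]] := A_mk_surj u0.
have [b0 [b1 [b2 [b3 ->]]]] := A_mk_surj u1.
have [c0 [c1 [c2 [c3 ->]]]] := A_mk_surj u2.
have [d0 [d1 [d2 [d3 ->]]]] := A_mk_surj u3.
rewrite (swap_psi_g coact_slots) swap_slots_one !slots_one -mk0.
rewrite !coact_component_mk !mkN !mkD.
case/slots_inj=> /slots_inj[/Cl_mk_inj[<- _ _ <-] _ _ /Cl_mk_inj[/subr0_eq-> _ _ _]].
case/slots_inj=> /Cl_mk_inj[_ <- <- _] _ _ /Cl_mk_inj[_ /addr0_eq<- _ _].
case/slots_inj=> /Cl_mk_inj[_ <- <- _] _ _ /Cl_mk_inj[_ -> _ _].
case/slots_inj=> /Cl_mk_inj[<- _ _ <-] _ _ /Cl_mk_inj[-> _ _ _].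
by exists b0, (- b3), c0, a1; rewrite opprK.
Qed.

(** An inhomogeneous system for T(x): T(g) supplies the constants a, b, c, d, and two solutions
    differ by a solution of the equation at h = 1 in [psi_1P]. *)
Lemma psi_xP (t : A \ox H) a b c d
    (s := slots (mk 0 d c 0) (mk a 0 0 (- b)) (mk c 0 0 0) (mk 0 b 0 0)) :
  cowreath_psi x s + cowreath_psi 1 t = t \ox 1 <->
  exists a' c' d' e, t = slots (mk a' 0 0 (d + c')) (mk 0 d' (- (a + e)) 0)
   (mk 0 c' (- c) 0) (mk e 0 0 b).
Proof.
split=> [|[a' [c' [d' [e ->]]]]]; rewrite swap_tensP; last first.
  rewrite (swap_psi_x1 coact_slots) swap_slots_one !slots_one -mk0.
  rewrite !coact_component_mk !mkN !mkD.
  by apply/slots_inj; split; apply/slots_inj; split; apply/Cl_mk_inj; split; ring.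
have [u0 [u1 [u2 [u3 ->]]]] := slots_surj t.
have [a0 [a1 [a2 [a3 ->]]]] := A_mk_surj u0.
have [b0 [b1 [b2 [b3 ->]]]] := A_mk_surj u1.
have [c0 [c1 [c2 [c3 ->]]]] := A_mk_surj u2.
have [d0 [d1 [d2 [d3 ->]]]] := A_mk_surj u3.
rewrite (swap_psi_x1 coact_slots) swap_slots_one !slots_one -mk0.
rewrite !coact_component_mk !mkN !mkD.
case/slots_inj=> /slots_inj[_ /Cl_mk_inj[_ -> -> _] _ /Cl_mk_inj[_ a3E _ _]].
have {a3E}-> : a3 = d + c1 by apply/subr0_eq; rewrite -[RHS]a3E; ring.
case/slots_inj=> /Cl_mk_inj[<- _ _ <-] _ _ /Cl_mk_inj[b2E _ _ _].
have {b2E}-> : b2 = - (a + d0) by apply/subr0_eq; rewrite -[RHS]b2E; ring.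
case/slots_inj=> /Cl_mk_inj[<- _ _ <-] _ _ /Cl_mk_inj[/addr0_eq<- _ _ _].
case/slots_inj=> /Cl_mk_inj[_ <- <- _] _ _ /Cl_mk_inj[_ /addr0_eq<- _ _].
by exists a0, c1, b1, d0; rewrite opprK.
Qed.

(** Likewise T(1) supplies the constants, and two solutions differ by a solution of the equation at
    h = g in [psi_gP]. *)
Lemma psi_gxP (t : A \ox H) a b c d
    (s := slots (mk a 0 0 b) (mk 0 d (- c) 0) (mk 0 b 0 0) (mk c 0 0 0)) :
  cowreath_psi (g * x) s + cowreath_psi g t = t \ox 1 <->
  exists a' b' c' d', t = slots (mk 0 d' (c' - a) 0) (mk a' 0 0 (d - b'))
   (mk c' 0 0 b) (mk 0 b' (- c) 0).
Proof.
split=> [|[a' [b' [c' [d' ->]]]]]; rewrite swap_tensP; last first.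
  rewrite (swap_psi_gxg coact_slots) swap_slots_one !slots_one -mk0.
  rewrite !coact_component_mk !mkN !mkD.
  by apply/slots_inj; split; apply/slots_inj; split; apply/Cl_mk_inj; split; ring.
have [u0 [u1 [u2 [u3 ->]]]] := slots_surj t.
have [a0 [a1 [a2 [a3 ->]]]] := A_mk_surj u0.
have [b0 [b1 [b2 [b3 ->]]]] := A_mk_surj u1.
have [c0 [c1 [c2 [c3 ->]]]] := A_mk_surj u2.
have [d0 [d1 [d2 [d3 ->]]]] := A_mk_surj u3.
rewrite (swap_psi_gxg coact_slots) swap_slots_one !slots_one -mk0.
rewrite !coact_component_mk !mkN !mkD.
case/slots_inj=> /slots_inj[/Cl_mk_inj[<- _ _ <-] _ _ /Cl_mk_inj[a2E _ _ _]].
have {a2E}-> : a2 = c0 - a by apply/subr0_eq; rewrite -[RHS]a2E; ring.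
case/slots_inj=> /Cl_mk_inj[_ <- <- _] _ _ /Cl_mk_inj[_ b3E _ _].
have {b3E}-> : b3 = d - d1 by apply/subr0_eq; rewrite -[RHS]b3E; ring.
case/slots_inj=> /Cl_mk_inj[_ <- <- _] _ _ /Cl_mk_inj[_ /addr0_eq<- _ _].
case/slots_inj=> /Cl_mk_inj[<- _ _ <-] _ _ /Cl_mk_inj[/addr0_eq<- _ _ _].
by exists b0, d1, c0, a1; rewrite opprK.
Qed.

(** * Both integral conditions tested on basis elements *)

Section Integral.
Variable T : {linear H -> tens A H}.

Let TN a : T (- a) = - T a. Proof. exact: linearN. Qed.

(* The second integral condition at a = G and at a = X, after evaluating the
   iterated coaction and S^-1(g) = g, S^-1(x) = - gx. *)
Definition G_condition (h : H) : Prop :=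
  (G \ox 1) * T (g * h * g) * (1 \ox g) = (1 \ox g) * T h * (G \ox 1).

Definition X_condition (h : H) : Prop :=
  (X \ox 1) * T (g * h * g) * (1 \ox g) + T (g * h * x) * (1 \ox g)
    - T (g * x * h) * (1 \ox g) - T h * (1 \ox (g * x))
  = (1 \ox g) * T h * (X \ox 1) - (1 \ox (g * x)) * T h.

(** The condition at a = GX. The one at X is taken at ghg because its leading term is then T(h),
    while its terms in T(ghg) are those the condition at G can move past G. *)
Lemma GX_condition (h : H) : G_condition h -> X_condition (g * h * g) ->
  ((G * X) \ox 1) * T h + (G \ox 1) * T (h * (g * x)) +
  (G \ox 1) * T (x * h * g) + (G \ox 1) * T (g * h * g) * (1 \ox x)
  = T h * ((G * X) \ox 1) + (1 \ox x) * T h * (G \ox 1).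
Proof.
move=> PG PX.
have gl a : g * (g * a) = a by rewrite mulrA H4_gg mul1r.
have ghgK : g * (g * h * g) * g = h.
  by rewrite -[g * (g * h * g) * g]mulrA -[g * h * g * g]mulrA H4_gg mulr1 gl.
have ghgx : g * (g * h * g) * x = h * (g * x) by rewrite -!mulrA gl.
have xghg : g * x * (g * h * g) = - (x * h * g) by rewrite !mulrA H4_mulE !mulNr.
have -> : (G * X) \ox 1 = (G \ox 1) * (X \ox 1) :> A \ox H by rewrite ox_mul mulr1.
(* Here t is T(h), u is T(ghg), p is T(hgx), and q is T(xhg) because gx · ghg = -xhg. *)
apply: (@twisted_module_mul _ (G \ox 1) (X \ox 1) (1 \ox g) (1 \ox x)
  (1 \ox (g * x)) _ _ _ _ _ _ _ _ _ PG).
1-5: by rewrite !ox_mul ?H4_mulE !mul1r ?mulr1 ?oxNr.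
by move: PX; rewrite /X_condition ghgK ghgx xghg TN mulNr opprK.
Qed.

Lemma psi_conditionP :
  (forall h : H, \sw_(h1, h2 <- comul H h) cowreath_psi h1 (T h2) = T h \ox 1) <->
  [/\ cowreath_psi 1 (T 1) = T 1 \ox 1, cowreath_psi g (T g) = T g \ox 1,
      cowreath_psi x (T g) + cowreath_psi 1 (T x) = T x \ox 1 &
      cowreath_psi (g * x) (T 1) + cowreath_psi g (T (g * x)) = T (g * x) \ox 1].
Proof.
have bl : bilin (fun h1 h2 => cowreath_psi h1 (T h2)).
  split=> [h2|h1 c h h']; first exact: psi_bilin.1.
  by rewrite linearP; apply: psi_bilin.2.
have [[[E1 Eg] Ex] Egx] := Cl_sw_coact bl; split=> [P|[P1 Pg Px Pgx]].
  split; [exact: etrans (esym E1) (P 1)|exact: etrans (esym Eg) (P g)|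
    exact: etrans (esym Ex) (P x)|exact: etrans (esym Egx) (P (g * x))].
apply: Cl_linear_ext; first exact: sw_coact_linear.
- by move=> c h h'; rewrite linearP !oxE.
- exact: etrans E1 P1.
- exact: etrans Eg Pg.
- exact: etrans Ex Px.
- exact: etrans Egx Pgx.
Qed.

(** Both sides are linear in a, so a = 1, G, X, GX suffice: a = 1 is trivial and a = GX is
    [GX_condition]. *)
Lemma module_conditionP :
  (forall (a : A) (h : H),
     \sw_(a0, a' <- coact A a) \sw_(a1, a'' <- comul H a')
       \sw_(a2, a3 <- comul H a'')
         (a0 \ox 1) * T (antipode_inv H a2 * h * a1) * (1 \ox antipode_inv H a3)
     = \sw_(a0, a1 <- coact A a)
         (1 \ox antipode_inv H a1) * T h * (a0 \ox 1)) <->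
  (forall h, G_condition h) /\ (forall h, X_condition h).
Proof.
pose F (S' : H -> H) (h : H) (a : A) (h1 h2 h3 : H) :=
  (a \ox 1) * T (S' h2 * h * h1) * (1 \ox S' h3).
have Flin (S' : {linear H -> H}) h :
    [/\ forall h1 h2 h3, linear (fun a => F S' h a h1 h2 h3),
    forall a h2 h3, linear (fun h1 => F S' h a h1 h2 h3),
    forall a h1 h3, linear (fun h2 => F S' h a h1 h2 h3) &
    forall a h1 h2, linear (F S' h a h1 h2)].
  split=> [h1 h2 h3 c a a'|a h2 h3 c h1 h1'|a h1 h3 c h2 h2'|a h1 h2 c h3 h3'];
    rewrite /F.
  - by rewrite oxDl oxZl !mulrDl -!scalerAl.
  - by rewrite mulrDr -scalerAr linearP mulrDr mulrDl -scalerAr -scalerAl.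
  - rewrite linearP !mulrDl -!scalerAl linearP mulrDr mulrDl.
    by rewrite -scalerAr -scalerAl.
  - by rewrite linearP oxDr oxZr mulrDr -scalerAr.
have Rlin (S' : {linear H -> H}) h : bilin (fun (a0 : A) a1 =>
    (1 \ox S' a1) * T h * (a0 \ox 1)).
  split=> [a1 c a a'|a c a1 a1'].
  - by rewrite oxDl oxZl mulrDr -scalerAr.
  - by rewrite linearP oxDr oxZr !mulrDl -!scalerAl.
have LE h := let: And4 l0 l1 l2 l3 := Flin (antipode_inv H) h in sw_coact3 l0 l1 l2 l3.
have RE h := Cl_sw_coact (Rlin (antipode_inv H) h).
have [[[L1 LG] LX] LGX] := (fun h => (LE h).1.1.1, fun h => (LE h).1.1.2,
  fun h => (LE h).1.2, fun h => (LE h).2).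
have [[[R1 RG] RX] RGX] := (fun h => (RE h).1.1.1, fun h => (RE h).1.1.2,
  fun h => (RE h).1.2, fun h => (RE h).2).
have S'E : (antipode_inv H 1 = 1) * (antipode_inv H g = g) *
    (antipode_inv H x = - (g * x)) * (antipode_inv H (g * x) = x).
  by rewrite !(H4_antipodeE k).
split=> [P|[PG PX] a h].
  split=> h.
    have := etrans (esym (LG h)) (etrans (P G h) (RG h)).
    by rewrite /F !S'E.
  have := etrans (esym (LX h)) (etrans (P X h) (RX h)).
  by rewrite /F !S'E !(ox_one, mul1r, mulr1, mulNr, oxNr, mulrN, TN, addrA).
move: a; apply: Cl_linear_ext; [exact: sw_coact_linear|exact: sw_coact_linear| | | |].
- by apply: etrans (L1 h) (etrans _ (esym (R1 h))); rewrite /F !S'E !(ox_one, mul1r, mulr1).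
- by apply: etrans (LG h) (etrans _ (esym (RG h))); rewrite /F !S'E; apply: PG.
- apply: etrans (LX h) (etrans _ (esym (RX h))).
  by rewrite /F !S'E !(ox_one, mul1r, mulr1, mulNr, oxNr, mulrN, TN, addrA); apply: PX.
- apply: etrans (LGX h) (etrans _ (esym (RGX h))).
  rewrite /F !S'E !(ox_one, mul1r, mulr1) !addrA; exact: GX_condition.
Qed.

(** Conjugation by g fixes 1 and g and negates x and gx, whence the signs. *)
Lemma G_conditionP : (forall h, G_condition h) <->
  [/\ (G \ox 1) * T 1 * (1 \ox g) = (1 \ox g) * T 1 * (G \ox 1),
      (G \ox 1) * T g * (1 \ox g) = (1 \ox g) * T g * (G \ox 1),
      (G \ox 1) * - T x * (1 \ox g) = (1 \ox g) * T x * (G \ox 1) &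
      (G \ox 1) * - T (g * x) * (1 \ox g) = (1 \ox g) * T (g * x) * (G \ox 1)].
Proof.
have E1 : g * 1 * g = 1 by rewrite mulr1 H4_gg.
have Eg : g * g * g = g by rewrite H4_gg mul1r.
have Ex : g * x * g = - x by rewrite H4_mulE.
have Egx : g * (g * x) * g = - (g * x) by rewrite !H4_mulE.
split=> [P|[P1 Pg Px Pgx]].
  have := (P 1, P g, P x, P (g * x)).
  by rewrite /G_condition E1 Eg Ex Egx !TN => -[[[]]].
have Tlin : linear (fun h => T (g * h * g)).
  by apply/linear_comp/linear_mul2 => c u v.
apply: Cl_linear_ext; first exact: linear_mul2.
- by apply: linear_mul2 => c u v; exact: linearP.
- by rewrite E1.
- by rewrite Eg.
- by rewrite Ex TN.
- by rewrite Egx TN.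
Qed.

(** The element ghx - gxh vanishes for h = 1, x, gx and is 2x for h = g. The zero products are kept
    so that all four equations fit [slots_X_condition]. *)
Lemma X_conditionP : (forall h, X_condition h) <->
  [/\ (X \ox 1) * T 1 * (1 \ox g) + 0 * (1 \ox g) - T 1 * (1 \ox (g * x))
      = (1 \ox g) * T 1 * (X \ox 1) - (1 \ox (g * x)) * T 1,
      (X \ox 1) * T g * (1 \ox g) + (T x + T x) * (1 \ox g) - T g * (1 \ox (g * x))
      = (1 \ox g) * T g * (X \ox 1) - (1 \ox (g * x)) * T g,
      (X \ox 1) * - T x * (1 \ox g) + 0 * (1 \ox g) - T x * (1 \ox (g * x))
      = (1 \ox g) * T x * (X \ox 1) - (1 \ox (g * x)) * T x &
      (X \ox 1) * - T (g * x) * (1 \ox g) + 0 * (1 \ox g) - T (g * x) * (1 \ox (g * x))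
      = (1 \ox g) * T (g * x) * (X \ox 1) - (1 \ox (g * x)) * T (g * x)].
Proof.
have TB a b : T (a - b) = T a - T b by exact: linearB.
pose lhs h := (X \ox 1) * T (g * h * g) * (1 \ox g) +
  T (g * h * x - g * x * h) * (1 \ox g) - T h * (1 \ox (g * x)).
have lhsP h : X_condition h <->
    lhs h = (1 \ox g) * T h * (X \ox 1) - (1 \ox (g * x)) * T h.
  by rewrite /X_condition /lhs TB [(T _ - T _) * _]mulrBl addrA.
have E1 : (g * 1 * g = 1) * (g * 1 * x - g * x * 1 = 0).
  by rewrite !mulr1 H4_gg subrr.
have Eg : (g * g * g = g) * (g * g * x - g * x * g = x + x).
  by rewrite !H4_mulE !mul1r opprK.
have Ex : (g * x * g = - x) * (g * x * x - g * x * x = 0).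
  by rewrite !H4_mulE subrr.
have Egx : (g * (g * x) * g = - (g * x)) * (g * (g * x) * x - g * x * (g * x) = 0).
  by rewrite !H4_mulE subrr.
have T0 : T 0 = 0 by exact: linear0.
have TD a b : T (a + b) = T a + T b by exact: linearD.
split=> [P|[P1 Pg Px Pgx] h].
  have := ((lhsP 1).1 (P 1), (lhsP g).1 (P g), (lhsP x).1 (P x), (lhsP (g * x)).1 (P (g * x))).
  by rewrite /lhs !E1 !Eg !Ex !Egx !TN T0 TD => -[[[]]].
apply/lhsP; move: h; apply: Cl_linear_ext.
- apply: linear_sub; last by apply: linear_mulr => c u v; exact: linearP.
  apply: linear_add; first by apply/linear_mul2/linear_comp/linear_mul2 => c u v.
  apply/linear_mulr/linear_comp; apply: linear_sub.
    by apply: linear_mul2 => c u v.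
  by apply: linear_mull => c u v.
- apply: linear_sub; first by apply: linear_mul2 => c u v; exact: linearP.
  by apply: linear_mull => c u v; exact: linearP.
- by rewrite /lhs !E1 T0.
- by rewrite /lhs !Eg TD.
- by rewrite /lhs !Ex TN T0.
- by rewrite /lhs !Egx TN T0.
Qed.

(* The redundant zeros and signs make the right-hand sides instances of the
   hypotheses of [scalars_module]. *)
Lemma integral_valuesE (p : integral_params k) :
  integral_values T p <->
  [/\ T 1 = slots (mk (pU p) 0 0 (pV p)) (mk 0 0 (- 0) 0) (mk 0 (pV p) 0 0)
        (mk 0 0 0 0),
      T g = slots (mk 0 (pB p) 0 0) (mk (pA p) 0 0 (- - pZ p)) (mk 0 0 0 0)
        (mk 0 (- pZ p) 0 0),
      T x = slots (mk (- (ga / 2 * pB p)) 0 0 (pB p + 0))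
        (mk 0 (- (- pZ p * be)) (- (pA p - pA p)) 0)
        (mk 0 0 (- 0) 0) (mk (- pA p) 0 0 (- pZ p)) &
      T (g * x) = slots (mk 0 (- pC p) (pD p - pU p) 0)
        (mk (ga / 2 * pE p) 0 0 (0 - pE p))
        (mk (pD p) 0 0 (pV p)) (mk 0 (pE p) (- 0) 0)].
Proof.
rewrite /integral_values /= slots_value1 slots_valueg slots_valuex slots_valuegx.
rewrite mkGX mk1 mkG mkX -!mk0 !mkZ !mkN !mkD.
rewrite !(mulr0, mulr1, addr0, add0r, oppr0, opprK, subr0, sub0r, subrr, mulNr).
by rewrite [be * _]mulrC.
Qed.

(** * The second condition as relations among the sixteen scalars left by the first *)

Section Scalars.
Variables a b c d a1 b1 c1 d1 a2 c2 d2 e2 a3 b3 c3 d3 : k.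
Hypothesis T1 : T 1 = slots (mk a 0 0 b) (mk 0 d (- c) 0) (mk 0 b 0 0) (mk c 0 0 0).
Hypothesis Tg : T g = slots (mk 0 d1 c1 0) (mk a1 0 0 (- b1)) (mk c1 0 0 0) (mk 0 b1 0 0).
Hypothesis Tx : T x = slots (mk a2 0 0 (d1 + c2)) (mk 0 d2 (- (a1 + e2)) 0)
   (mk 0 c2 (- c1) 0) (mk e2 0 0 b1).
Hypothesis Tgx : T (g * x) = slots (mk 0 d3 (c3 - a) 0) (mk a3 0 0 (d - b3))
   (mk c3 0 0 b) (mk 0 b3 (- c) 0).

Let slots0 : 0 = slots (mk 0 0 0 0) (mk 0 0 0 0) (mk 0 0 0 0) (mk 0 0 0 0) :> A \ox H.
Proof. by rewrite mk0 -slots_one ox0l. Qed.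

Let TxN : - T x = slots (mk (- a2) (- 0) (- 0) (- (d1 + c2)))
  (mk (- 0) (- d2) (- - (a1 + e2)) (- 0)) (mk (- 0) (- c2) (- - c1) (- 0))
  (mk (- e2) (- 0) (- 0) (- b1)).
Proof. by rewrite Tx slots_opp !mkN. Qed.

Let TgxN : - T (g * x) = slots (mk (- 0) (- d3) (- (c3 - a)) (- 0))
  (mk (- a3) (- 0) (- 0) (- (d - b3))) (mk (- c3) (- 0) (- 0) (- b))
  (mk (- 0) (- b3) (- - c) (- 0)).
Proof. by rewrite Tgx slots_opp !mkN. Qed.

Let Tx2 : T x + T x = slots (mk (a2 + a2) (0 + 0) (0 + 0) ((d1 + c2) + (d1 + c2)))
  (mk (0 + 0) (d2 + d2) (- (a1 + e2) - (a1 + e2)) (0 + 0))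
  (mk (0 + 0) (c2 + c2) (- c1 - c1) (0 + 0)) (mk (e2 + e2) (0 + 0) (0 + 0) (b1 + b1)).
Proof. by rewrite Tx slots_add !mkD. Qed.

(** Reduces an equation to a known one by an identity between differences, which [ring] can
    check. *)
Let eq_of_sub (p q l r : k) : p = q -> l - r = q - p -> l = r.
Proof. by move=> -> /eqP; rewrite subrr subr_eq0 => /eqP. Qed.

Lemma scalars_module :
  [/\ [/\ b * al = 0, b * be = 0 & b * ga = 0], b1 * al = 0 /\ b1 * ga = 0,
      [/\ c = 0, d = 0, c1 = 0 & c2 = 0],
      [/\ d2 = - (b1 * be), e2 = - a1, 2 * a2 = - (ga * d1) & 2 * a3 = ga * b3] &
      (c3 - a) * ga = - (2 * (al * d3)) /\ d3 * ga = - (2 * (be * (c3 - a)))] ->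
  (forall h, G_condition h) /\ (forall h, X_condition h).
Proof.
move=> [[bal bbe bga] [b1al b1ga] [c0 d0 c10 c20] [d2E e2E a2E a3E] [r1 r2]].
split.
  (* After substitution, each coordinate equation is an identity or follows from a single one of the
     remaining relations. *)
  apply/G_conditionP; split; rewrite ?TxN ?TgxN ?T1 ?Tg ?Tx ?Tgx;
    apply/slots_G_condition; rewrite !mulG !mulrG ?mkN;
    rewrite ?c0 ?d0 ?c10 ?c20 ?d2E ?e2E; split; apply/Cl_mk_inj; split;
    first [by ring|by ring: bal|by ring: bga|by ring: b1al|by ring: b1ga|
      by apply: (eq_of_sub a2E); ring|by apply: (eq_of_sub a3E); ring|
      by apply: (eq_of_sub r1); ring].
apply/X_conditionP; split; rewrite ?TxN ?TgxN ?Tx2 ?T1 ?Tg ?Tx ?Tgx ?slots0;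
  apply/slots_X_condition; rewrite !mulX !mulrX ?mkN !mkD;
  rewrite ?c0 ?d0 ?c10 ?c20 ?d2E ?e2E; split; apply/Cl_mk_inj; split;
  first [by ring|by ring: bbe|by ring: bga|by ring: b1ga|
    by apply: (eq_of_sub a2E); ring|by apply: (eq_of_sub a3E); ring|
    by apply: (eq_of_sub (esym a2E)); ring|by apply: (eq_of_sub r2); ring].
Qed.

Hypothesis two_neq0 : (2 : k) != 0.

(** Characteristic different from 2 enters here: coordinate equations such as -c = c must give c =
    0. *)
Let half (p q t : k) : p = q -> 2 * t = p - q -> t = 0.
Proof.
by move=> -> /eqP; rewrite subrr mulf_eq0 (negPf two_neq0) /= => /eqP.
Qed.

Let diff0 (p q t : k) : p = q -> t = p - q -> t = 0.
Proof. by move=> -> ->; rewrite subrr. Qed.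

(** At h = 1, the conditions at G and X yield c = d = 0 and the relations on b; at h = g, those on
    b1 and the values of c1, c2, d2, e2, a2; at h = gx, the value of a3 and the two relations
    between c3 - a and d3. *)
Lemma module_scalars : (forall h, G_condition h) -> (forall h, X_condition h) ->
  [/\ [/\ b * al = 0, b * be = 0 & b * ga = 0], b1 * al = 0 /\ b1 * ga = 0,
      [/\ c = 0, d = 0, c1 = 0 & c2 = 0],
      [/\ d2 = - (b1 * be), e2 = - a1, 2 * a2 = - (ga * d1) & 2 * a3 = ga * b3] &
      (c3 - a) * ga = - (2 * (al * d3)) /\ d3 * ga = - (2 * (be * (c3 - a)))].
Proof.
move=> /G_conditionP[P1 Pg _ Pgx] /X_conditionP[Q1 Qg _ Qgx].
move: P1; rewrite T1 => /slots_G_condition[]; rewrite !mulG !mulrG.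
(* [half] and [diff0] turn a coordinate equation p = q into a criterion for t = 0, with t still
   open. It is fixed when the criterion is applied below, where [ring] checks that p - q is 2t or
   t. *)
move=> /Cl_mk_inj[_ _ _ /esym/half c0] /Cl_mk_inj[_ /esym/diff0 bga /half bal _] _ _.
move: Pg; rewrite Tg => /slots_G_condition[]; rewrite !mulG !mulrG.
move=> /Cl_mk_inj[_ /diff0 b1ga /esym/half b1al _] /Cl_mk_inj[_ _ _ /half c10] _ _.
move: Pgx; rewrite TgxN Tgx => /slots_G_condition[]; rewrite !mulG !mulrG.
move=> /Cl_mk_inj[_ /esym/diff0 a3E _ _] /Cl_mk_inj[/esym/diff0 r1 _ _ _] _ _.
move: Q1; rewrite T1 slots0 => /slots_X_condition[]; rewrite !mulX !mulrX !mkD.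
move=> /Cl_mk_inj[_ _ _ /esym/half d0] /Cl_mk_inj[_ /esym/half bbe _ _] _ _.
move: Qg; rewrite Tg Tx2 => /slots_X_condition[]; rewrite !mulX !mulrX !mkD.
move=> /Cl_mk_inj[_ /half d2E /esym/half e2E _] /Cl_mk_inj[/diff0 a2E _ _ /half c20] _ _.
move: Qgx; rewrite TgxN Tgx slots0 => /slots_X_condition[]; rewrite !mulX !mulrX !mkD.
move=> _ /Cl_mk_inj[/esym/diff0 r2 _ _ _] _ _.
(* These two come first because the values of e2 and a3 use them. *)
have {}b1ga : b1 * ga = 0 by apply: b1ga; ring.
have {}d0 : d = 0 by apply: d0; ring.
split; split.
- by apply: bal; ring.
- by apply: bbe; ring.
- by apply: bga; ring.
- by apply: b1al; ring.
- by [].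
- by apply: c0; ring.
- by [].
- by apply: c10; ring.
- by apply: c20; ring.
- by apply/subr0_eq/d2E; ring.
- by apply/subr0_eq/e2E; ring: b1ga.
- by apply/subr0_eq/a2E; ring.
- by apply/subr0_eq/a3E; ring: d0.
- by apply/subr0_eq/r1; ring.
- by apply/subr0_eq/r2; ring.
Qed.

End Scalars.
End Integral.
End CliffordIntegrals.

Theorem theorem5p1 (k : fieldType) (char_neq2 : 2%N \notin [pchar k])
    (al be ga : k) :
  (forall T : {linear H4 k -> tens (Cl_comod al be ga) (H4 k)},
     is_integral T <->
     exists p : integral_params k,
       param_constraints al be ga p /\ integral_values T p) /\
  (forall (T : {linear H4 k -> tens (Cl_comod al be ga) (H4 k)})
          (p : integral_params k),
     param_constraints al be ga p -> integral_values T p ->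
     (total_integral T <-> pU p = 1 /\ pV p = 0)).
Proof.
have two_neq0 : (2 : k) != 0 by apply: contra char_neq2 => /eqP e; rewrite inE /= e eqxx.
split=> [T|T p _ /integral_valuesE[T1 _ _ _]]; last first.
  (* Totality compares the components of T(1) with those of 1 ⊗ 1, namely 1, 0, 0, 0. *)
  rewrite /total_integral T1 slots_one -(Cl_mk0 al be ga) Cl_oneE.
  split=> [/slots_inj[/Cl_mk_inj[-> _ _ ->] _ _ _]|[-> ->]] //.
  by rewrite oppr0.
split=> [[/psi_conditionP[P1 Pg Px Pgx] /module_conditionP[PG PX]]|].
  have [a [b [c [d T1]]]] := (psi_1P _).1 P1.
  have [a1 [b1 [c1 [d1 Tg]]]] := (psi_gP _).1 Pg.
  rewrite Tg in Px; have [a2 [c2 [d2 [e2 Tx]]]] := (psi_xP _ _ _ _ _).1 Px.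
  rewrite T1 in Pgx; have [a3 [b3 [c3 [d3 Tgx]]]] := (psi_gxP _ _ _ _ _).1 Pgx.
  have [[bal bbe bga] [b1al b1ga] [c0 d0 c10 c20] [d2E e2E a2E a3E] [r1 r2]] :=
    module_scalars T1 Tg Tx Tgx two_neq0 PG PX.
  (* The parameters are coordinates of T(g), T(gx) and T(1). The signs of C and Z come from the
     terms -C(G ⊗ 1) in T(gx) and -Z(G ⊗ gx) in T(g). *)
  exists (IntegralParams a1 d1 (- d3) c3 b3 a b (- b1)); split.
    split=> //=.
    - by rewrite !mulNr b1al b1ga oppr0.
    - by rewrite r1; ring.
    - by rewrite !mulNr r2; ring.
  apply/integral_valuesE => /=.
  have a2E' : a2 = - (ga / 2 * d1) by apply: (mulfI two_neq0); rewrite a2E; field.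
  have a3E' : a3 = ga / 2 * b3 by apply: (mulfI two_neq0); rewrite a3E; field.
  by rewrite T1 Tg Tx Tgx a2E' a3E' c0 d0 c10 c20 d2E e2E !opprK.
move=> [p [[[Zal Zga] [Val Vbe Vga] r1 r2] /integral_valuesE[T1 Tg Tx Tgx]]].
(* Conversely, [integral_valuesE] presents the values in the shape imposed by the first condition,
   so only the relations among the scalars have to be checked. *)
have [PG PX] : (forall h, G_condition T h) /\ (forall h, X_condition T h).
  apply: (scalars_module T1 Tg Tx Tgx); split=> //.
  - by rewrite !mulNr Zal Zga oppr0.
  - by split=> //; field.
  - split; apply/subr0_eq; [rewrite -[RHS]r1|rewrite -[RHS]r2]; ring.
split; [apply/psi_conditionP|exact/module_conditionP].
split.
- by apply/psi_1P; rewrite T1; do 4!eexists.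
- by apply/psi_gP; rewrite Tg; do 4!eexists.
- by rewrite Tg; apply/psi_xP; rewrite Tx; do 4!eexists.
- by rewrite T1; apply/psi_gxP; rewrite Tgx; do 4!eexists.
Qed.
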